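(* Let $\mathfrak{C}$ be the Cantor set and let $\Gamma \leq \mathrm{Homeo}(\mathfrak{C})$ be a topological full group such that its action on $\mathfrak{C}$ is extremely proximal. Then $\Gamma$ is boundedly acyclic.
   Context: For a subgroup $\Gamma\le\mathrm{Homeo}(\mathfrak{C})$, its topological full group $[[\Gamma]]$ is the set of $g\in\mathrm{Homeo}(\mathfrak{C})$ such that for each $x\in\mathfrak{C}$ there exist a neighbourhood $U$ of $x$ and $\gamma\in\Gamma$ with $g|_U=\gamma|_U$. A subgroup $\Gamma\le\mathrm{Homeo}(\mathfrak{C})$ is a topological full group if $[[\Gamma]]=\Gamma$. The action of $\Gamma$ on $\mathfrak{C}$ is extremely proximal if for any nonempty proper clopen sets $V_1,V_2\subsetneq\mathfrak{C}$ there exists $\gamma\in\Gamma$ with $\gamma(V_2)\subsetneq V_1$. A group $\Gamma$ (viewed as a discrete group) is boundedly acyclic if its bounded cohomology $\mathrm{H}_b^i(\Gamma,\mathbb{R})=0$ for all $i\ge 1$. *)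

(* Defs.v *)
From HB Require Import structures.
From mathcomp Require Import all_boot all_order all_algebra.
From mathcomp Require Import mathcomp_extra boolp classical_sets functions.
From mathcomp Require Import reals topology normedtype cantor.

Set Implicit Arguments.
Unset Strict Implicit.
Unset Printing Implicit Defensive.

Import Order.TTheory GRing.Theory Num.Theory.
Import numFieldNormedType.Exports.

Local Open Scope classical_set_scope.
Local Open Scope ring_scope.

Record homeo (T : topologicalType) : Type := Homeo {
  homeo_fun :> T -> T;
  homeo_inv : T -> T;
  homeo_funK : cancel homeo_fun homeo_inv;
  homeo_invK : cancel homeo_inv homeo_fun;
  homeo_continuous : continuous homeo_fun;
  homeo_inv_continuous : continuous homeo_inv }.

Section HomeoGroup.
Variable T : topologicalType.
Implicit Types f g h : homeo T.

Lemma homeo_ext f g : homeo_fun f =1 homeo_fun g -> f = g.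
Proof.
case: f g => [f f' fK f'K cf cf'] [g g' gK g'K cg cg'] /= /funext fg.
subst g; have gf : g' = f' by apply/funext => x; rewrite -[in LHS](f'K x) gK.
by subst g'; congr Homeo; exact: Prop_irrelevance.
Qed.

HB.instance Definition _ := gen_eqMixin (homeo T).
HB.instance Definition _ := gen_choiceMixin (homeo T).

Definition homeo_one : homeo T :=
  @Homeo T id id (frefl id) (frefl id) (fun=> cvg_id) (fun=> cvg_id).

Definition homeo_mul f g : homeo T :=
  @Homeo T (f \o g) (homeo_inv g \o homeo_inv f)
    (can_comp (@homeo_funK _ f) (@homeo_funK _ g))
    (can_comp (@homeo_invK _ g) (@homeo_invK _ f))
    (fun x => continuous_comp (@homeo_continuous _ g x)
                              (@homeo_continuous _ f (g x)))
    (fun x => continuous_comp (@homeo_inv_continuous _ f x)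
                              (@homeo_inv_continuous _ g (homeo_inv f x))).

Definition homeo_inverse f : homeo T :=
  Homeo (@homeo_invK _ f) (@homeo_funK _ f)
        (@homeo_inv_continuous _ f) (@homeo_continuous _ f).

Fact homeo_mulgA : associative homeo_mul.
Proof. by move=> f g h; exact: homeo_ext. Qed.

Fact homeo_mul1g : left_id homeo_one homeo_mul.
Proof. by move=> f; exact: homeo_ext. Qed.

Fact homeo_mulg1 : right_id homeo_one homeo_mul.
Proof. by move=> f; exact: homeo_ext. Qed.

Fact homeo_mulVg : left_inverse homeo_one homeo_inverse homeo_mul.
Proof. by move=> f; apply: homeo_ext => x /=; rewrite homeo_funK. Qed.

Fact homeo_mulgV : right_inverse homeo_one homeo_inverse homeo_mul.
Proof. by move=> f; apply: homeo_ext => x /=; rewrite homeo_invK. Qed.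

HB.instance Definition _ := isGroup.Build (homeo T)
  homeo_mulgA homeo_mul1g homeo_mulg1 homeo_mulVg homeo_mulgV.

Definition topological_full_group (Gamma : groupClosed (homeo T)) :
    set (homeo T) :=
  [set g : homeo T | forall x : T, exists2 U : set T, nbhs x U &
     exists2 gamma : homeo T, gamma \in Gamma &
       forall y, U y -> g y = gamma y].

Definition is_topological_full_group (Gamma : groupClosed (homeo T)) : Prop :=
  topological_full_group Gamma = [set g : homeo T | g \in Gamma].

Definition extremely_proximal (Gamma : groupClosed (homeo T)) : Prop :=
  forall V1 V2 : set T,
    clopen V1 -> V1 !=set0 -> V1 `<` setT ->
    clopen V2 -> V2 !=set0 -> V2 `<` setT ->
    exists2 gamma : homeo T, gamma \in Gamma & gamma @` V2 `<` V1.

End HomeoGroup.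

Section SubgroupType.
Variables (G : groupType) (S : groupClosed G).

Definition subgroup_type : Type := {x : G | x \in S}.

HB.instance Definition _ := SubChoice.on subgroup_type.

Fact subgroup_type_closed : group_closed [pred x | x \in S].
Proof.
split=> [|x y xS yS]; rewrite inE; first exact: gpred1.
exact: gpredF.
Qed.

HB.instance Definition _ := SubChoice_isSubGroup.Build G _ subgroup_type
  subgroup_type_closed.

End SubgroupType.

(* Bounded cohomology of the discrete group G with trivial real coefficients,
   computed by the complex of bounded homogeneous cochains. *)
Section BoundedCohomology.
Variables (R : realType) (G : groupType).

Definition cochain (n : nat) : Type := ('I_n.+1 -> G) -> R.

HB.instance Definition _ n := GRing.Lmodule.on (cochain n).

(* (d f)(g_0, ..., g_{n+1}) = \sum_i (-1)^i f(g_0, ..., ^g_i, ..., g_{n+1}) *)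
Definition differential n (f : cochain n) : cochain n.+1 :=
  fun g : 'I_n.+2 -> G => \sum_(i < n.+2) (-1) ^+ i * f (g \o lift i).

Definition invariant_cochain n (f : cochain n) : Prop :=
  forall (h : G) (g : 'I_n.+1 -> G), f (fun i => (h * g i)%g) = f g.

Definition bounded_cochain n (f : cochain n) : Prop :=
  invariant_cochain f /\ bounded_fun f.

Fact differentialB n (f g : cochain n) :
  differential (f - g) = differential f - differential g.
Proof.
apply/funext => x; rewrite /differential !fctE -sumrB.
by apply: eq_bigr => i _; rewrite -mulrBr.
Qed.

Fact differential0 n : differential (0 : cochain n) = 0.
Proof.
by rewrite -[X in differential X](subrr 0) differentialB subrr.
Qed.

Fact bounded_cochain0 n : bounded_cochain (0 : cochain n).
Proof.
split=> //; exists 0; split=> // M M0 x _ /=.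
by rewrite normr0 ltW.
Qed.

Fact bounded_cochainB n (f g : cochain n) :
  bounded_cochain f -> bounded_cochain g -> bounded_cochain (f - g).
Proof.
move=> [fI fB] [gI gB]; split; first by move=> h x; rewrite !fctE fI gI.
exact: (bounded_funD fB (bounded_funN gB)).
Qed.

Definition bounded_cocycle n (f : cochain n) : Prop :=
  bounded_cochain f /\ differential f = 0.

Definition bcocycle n : Type := {f : cochain n | `[< bounded_cocycle f >]}.

HB.instance Definition _ n := SubChoice.on (bcocycle n).

Fact bounded_cocycle_closed n :
  zmod_closed [pred f : cochain n | `[< bounded_cocycle f >]].
Proof.
split=> [|f g].
  by apply/asboolP; split; [exact: bounded_cochain0 | exact: differential0].
move=> /asboolP[fB df] /asboolP[gB dg]; apply/asboolP; split.
  exact: bounded_cochainB.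
by rewrite differentialB df dg subrr.
Qed.

HB.instance Definition _ n := GRing.SubChoice_isSubZmodule.Build
  (cochain n) _ (bcocycle n) (@bounded_cocycle_closed n).

(* The complex starts in degree 0, so only 0 is a coboundary there. *)
Definition bounded_coboundary n : bcocycle n -> Prop :=
  match n with
  | 0 => fun z => z = 0
  | m.+1 => fun z =>
      exists2 f : cochain m, bounded_cochain f & val z = differential f
  end.

Definition bcoboundary n : pred (bcocycle n) :=
  fun z => `[< bounded_coboundary z >].

Fact bcoboundary_closed n : zmod_closed (@bcoboundary n).
Proof.
split=> [|y z]; rewrite !unfold_in /bcoboundary.
  apply/asboolP; case: n => [|m] //=; exists 0; first exact: bounded_cochain0.
  by rewrite differential0.
move=> /asboolP yB /asboolP zB; apply/asboolP.
case: n y z yB zB => [|m] y z /= => [->->|]; first by rewrite subrr.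
move=> [f fB yf] [g gB zg]; exists (f - g); first exact: bounded_cochainB.
by rewrite differentialB -yf -zg.
Qed.

HB.instance Definition _ n := GRing.isZmodClosed.Build (bcocycle n)
  (@bcoboundary n) (@bcoboundary_closed n).

Definition bounded_cohomology (n : nat) : zmodType :=
  Quotient.quot (GRing.ZmodClosed.clone _ (@bcoboundary n) _).

Definition boundedly_acyclic : Prop :=
  forall i : nat, (1 <= i)%N -> forall c : bounded_cohomology i, c = 0.

End BoundedCohomology.

(* Main.v *)
(* Call a subgroup L "commuting" if every finite subset E of L has conjugates
   t_j E t_j^-1 (t_j in L, j in nat) commuting with one another for distinct indices.

   Commuting subgroups have no bounded cohomology.  Let f be a bounded L-invariant cocycle.
   Precomposing f with the conjugation by t_j, followed by right multiplication by an
   independent random element prod_k t_k w_k t_k^-1 (k < N, the w_k being i.i.d. random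
   words in E), changes f by the coboundary of a uniformly bounded prism.  Left
   multiplication by t_j e t_j^-1 changes only the law of the j-th factor, and by an almost
   bounded density, so by the law of large numbers the average of the new cocycles over
   j < N is nearly constant on E.  An ultralimit over E and N writes f as a coboundary plus
   a constant.

   For a full extremely proximal group Gamma, let X be the set of germs at a base point of
   elements of Gamma.  Gamma is transitive on tuples of germs with distinct base points, and
   the stabilizers of such tuples are commuting: finitely many elements are supported in a
   proper clopen set U, and involutions of the full group exchange U with copies of it inside
   disjoint small clopen sets.  In the double complex of bounded invariant functions on
   Gamma^p x X^(q) the columns are exact by the first part.  The rows are exact by coning with
   a germ that tends to infinity along an ultrafilter, or by transitivity when p = 0.  Hence
   the complex of Gamma is exact. *)

From HB Require Import structures.
From mathcomp Require Import all_boot all_order all_algebra generic_quotient ring_quotient.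
From mathcomp Require Import mathcomp_extra boolp classical_sets functions.
From mathcomp Require Import reals topology normedtype cantor.
From mathcomp Require Import ring lra zify.
Require Import Defs.

Set Implicit Arguments.
Unset Strict Implicit.
Unset Printing Implicit Defensive.

Import Order.TTheory GRing.Theory Num.Theory.
Import numFieldNormedType.Exports.

Local Open Scope ring_scope.

(** * The augmented simplicial cochain complex on finite sequences *)

Section Differential.
Variables (R : realType) (T : eqType).
Implicit Types (f g : seq T -> R) (s u : seq T).

(* Augmented: a cochain of degree n lives on sequences of size n + 1, and
   [sdiff f [:: y] = f [::]]. *)
Fixpoint sdiff f s : R :=
  if s is y :: s' then f s' - sdiff (fun u => f (y :: u)) s' else 0.

Lemma sdiffB f g s :
  sdiff (fun u => f u - g u) s = sdiff f s - sdiff g s.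
Proof.
by elim: s f g => [|y s IH] f g /=; rewrite ?subrr // IH; ring.
Qed.

Lemma sdiff_sdiff f s : sdiff (sdiff f) s = 0.
Proof.
elim: s f => [|y s IH] f //=.
by rewrite sdiffB IH subr0 subrr.
Qed.

(** Serves to compare cochains on generic tuples only: every face of a generic tuple is a
    subsequence of it, hence generic. *)
Lemma eq_sdiff_subseq f g s :
  (forall u, subseq u s -> (size u).+1 = size s -> f u = g u) ->
  sdiff f s = sdiff g s.
Proof.
elim: s f g => [|y s IH] f g fg //=.
congr (_ - _); first by apply: fg => //; exact: subseq_cons.
apply: IH => u us su; apply: fg => /=; last by rewrite su.
by rewrite eqxx.
Qed.

Lemma eq_sdiff_size f g s :
  (forall u, (size u).+1 = size s -> f u = g u) -> sdiff f s = sdiff g s.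
Proof. by move=> fg; apply: eq_sdiff_subseq => u _; exact: fg. Qed.

Lemma sdiff_cst (c : R) s : sdiff (fun=> c) s = if odd (size s) then c else 0.
Proof.
by elim: s => [|y s IH] //=; rewrite IH; case: odd; rewrite /= ?subrr ?subr0.
Qed.

Lemma sdiff_bound f s (C : R) :
  (forall u, (size u).+1 = size s -> `|f u| <= C) ->
  `|sdiff f s| <= (size s)%:R * C.
Proof.
elim: s f => [|y s IH] f fC /=; first by rewrite normr0 mul0r.
apply: (le_trans (ler_normB _ _)); rewrite -natr1 mulrDl mul1r addrC.
by apply: lerD; [apply: IH => u su; apply: fC => /=; rewrite su | exact: fC].
Qed.

Lemma sdiff_sum f s : sdiff f s =
  \sum_(i < size s) (-1) ^+ i * f (take i s ++ drop i.+1 s).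
Proof.
elim: s f => [|y s IH] f /=; first by rewrite big_ord0.
rewrite big_ord_recl /= expr0 mul1r drop0 IH -sumrN; congr (_ + _).
by apply: eq_bigr => i _ /=; rewrite exprS mulN1r mulNr.
Qed.

End Differential.

Lemma sdiff_map (R : realType) (T T' : eqType) (h : T -> T') (f : seq T' -> R) s :
  sdiff (fun u => f (map h u)) s = sdiff f (map h s).
Proof. by elim: s f => [|y s IH] f //=; congr (_ - _); rewrite -IH. Qed.

Lemma sdiff_swap (R : realType) (T T' : eqType) (w : seq T -> seq T' -> R) s s' :
  sdiff (fun u => sdiff (w u) s') s = sdiff (fun v => sdiff (w^~ v) s) s'.
Proof.
elim: s w => [|y s IH] w /=; first by rewrite sdiff_cst if_same.
by rewrite IH -sdiffB.
Qed.

(** * Finitely additive means *)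

Section Mean.
Variable R : realType.

(** An expectation defined on all real functions, without boundedness or measurability: the laws
    used are built from Dirac masses by finite averages and products, so they have finite
    support. *)
Record mean (A : Type) := Mean {
  mean_fun :> (A -> R) -> R;
  meanB : forall f g, mean_fun (fun a => f a - g a) = mean_fun f - mean_fun g;
  meanZ : forall c f, mean_fun (fun a => c * f a) = c * mean_fun f;
  mean_ge0 : forall f, (forall a, 0 <= f a) -> 0 <= mean_fun f;
  mean1 : mean_fun (fun=> 1) = 1 }.

Section Theory.
Variables (A : Type) (M : mean A).
Implicit Types f g : A -> R.

Lemma mean_cst c : M (fun=> c) = c.
Proof. by rewrite -[RHS]mulr1 -(mean1 M) -meanZ;
   congr (M _); apply/funext => a; rewrite mulr1. Qed.

Lemma meanN f : M (fun a => - f a) = - M f.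
Proof.
rewrite -[RHS]mulN1r -meanZ; congr (M _); apply/funext => a.
by rewrite mulN1r.
Qed.

Lemma meanD f g : M (fun a => f a + g a) = M f + M g.
Proof.
rewrite -[g in RHS]opprK -[M (- - g)]opprK -meanN -meanB.
by congr (M _); apply/funext => a; rewrite !fctE !opprK.
Qed.

Lemma le_mean f g : (forall a, f a <= g a) -> M f <= M g.
Proof. by move=> fg; rewrite -subr_ge0 -meanB; apply: mean_ge0 => a; rewrite subr_ge0. Qed.

Lemma mean_norm_le f C : (forall a, `|f a| <= C) -> `|M f| <= C.
Proof.
move=> fC; rewrite ler_norml -(mean_cst C) -meanN; apply/andP.
by split; apply: le_mean => a; move: (fC a); rewrite ler_norml => /andP[].
Qed.

Lemma mean_sum (I : Type) (r : seq I) (F : I -> A -> R) :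
  M (fun a => \sum_(i <- r) F i a) = \sum_(i <- r) M (F i).
Proof.
elim: r => [|i r IH].
  by rewrite big_nil -[RHS](mean_cst 0); congr (M _); apply/funext => a; rewrite big_nil.
rewrite big_cons -IH -meanD; congr (M _); apply/funext => a.
by rewrite big_cons.
Qed.

Lemma meanZr c f : M (fun a => f a * c) = M f * c.
Proof. by rewrite mulrC -meanZ; congr (M _); apply/funext => a; rewrite mulrC. Qed.

Lemma sdiff_mean (T : eqType) (h : A -> seq T -> R) s :
  sdiff (fun u => M (h^~ u)) s = M (fun a => sdiff (h a) s).
Proof.
elim: s h => [|y s IH] h /=; first by rewrite mean_cst.
by rewrite (IH (fun a u => h a (y :: u))) -meanB.
Qed.

(* Chebyshev, with a parameter instead of a square root. *)
Lemma mean_norm_sqr f eps : 0 < eps -> M (fun a => f a ^+ 2) <= eps ^+ 2 ->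
  M (fun a => `|f a|) <= eps.
Proof.
move=> e0 fe; have e2 : (2 * eps)^-1 * 2 * eps = 1 by field; rewrite gt_eqF.
apply: (@le_trans _ _ (M (fun a => (2 * eps)^-1 * f a ^+ 2 + eps / 2))).
  apply: le_mean => a; rewrite -(real_normK (num_real (f a))).
  rewrite -subr_ge0; set x := `|f a|.
  have -> : (2 * eps)^-1 * x ^+ 2 + eps / 2 - x =
    (2 * eps)^-1 * (x - eps) ^+ 2 by field; rewrite gt_eqF.
  by rewrite mulr_ge0 ?sqr_ge0 // invr_ge0; lra.
rewrite meanD meanZ mean_cst.
have : (2 * eps)^-1 * M (fun a => f a ^+ 2) <= (2 * eps)^-1 * eps ^+ 2.
  by rewrite ler_pM2l // invr_gt0; lra.
have -> : (2 * eps)^-1 * eps ^+ 2 = eps / 2 by field; rewrite gt_eqF.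
lra.
Qed.

End Theory.

Section Average.
Variables (A : Type) (n : nat) (M : 'I_n.+1 -> mean A).

Let avg (f : A -> R) : R := n.+1%:R^-1 * \sum_(i < n.+1) M i f.

Fact avgB f g : avg (fun a => f a - g a) = avg f - avg g.
Proof.
rewrite /avg -mulrBr -sumrB; congr (_ * _).
by apply: eq_bigr => i _; rewrite meanB.
Qed.

Fact avgZ c f : avg (fun a => c * f a) = c * avg f.
Proof.
rewrite /avg mulrCA; congr (_ * _); rewrite mulr_sumr.
by apply: eq_bigr => i _; rewrite meanZ.
Qed.

Fact avg_ge0 f : (forall a, 0 <= f a) -> 0 <= avg f.
Proof.
move=> f0; rewrite /avg mulr_ge0 ?invr_ge0 // sumr_ge0 // => i _.
exact: mean_ge0.
Qed.

Fact avg1 : avg (fun=> 1) = 1.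
Proof.
rewrite /avg (eq_bigr (fun=> 1)) => [|i _]; last exact: mean1.
by rewrite sumr_const card_ord mulVf // pnatr_eq0.
Qed.

Definition mean_avg : mean A := Mean avgB avgZ avg_ge0 avg1.

End Average.

Section Dirac.
Variables (A : Type) (a : A).

Definition mean_dirac : mean A :=
  @Mean A (fun f => f a) (fun _ _ => erefl) (fun _ _ => erefl)
    (fun _ f0 => f0 a) erefl.

End Dirac.

Section Power.
Variables (A : Type) (M : mean A).

Fixpoint mpow_fun n (F : seq A -> R) : R :=
  if n is n'.+1 then M (fun a => mpow_fun n' (fun s => F (a :: s))) else F [::].

Fact mpowB n F G :
  mpow_fun n (fun s => F s - G s) = mpow_fun n F - mpow_fun n G.
Proof.
elim: n F G => [|n IH] F G //=; rewrite -meanB; congr (M _).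
by apply/funext => a; rewrite IH.
Qed.

Fact mpowZ n c F : mpow_fun n (fun s => c * F s) = c * mpow_fun n F.
Proof.
elim: n F => [|n IH] F //=; rewrite -meanZ; congr (M _).
by apply/funext => a; rewrite IH.
Qed.

Fact mpow_ge0 n F : (forall s, 0 <= F s) -> 0 <= mpow_fun n F.
Proof. by elim: n F => [|n IH] F F0 //=; apply: mean_ge0 => a; exact: IH. Qed.

Fact mpow1 n : mpow_fun n (fun=> 1) = 1.
Proof. by elim: n => [|n IH] //=; rewrite IH mean_cst. Qed.

(* The law of a sequence of n independent samples of M. *)
Definition mpow n : mean (seq A) :=
  Mean (@mpowB n) (@mpowZ n) (@mpow_ge0 n) (mpow1 n).

Lemma mpowS n F : mpow n.+1 F = M (fun a => mpow n (fun s => F (a :: s))).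
Proof. by []. Qed.

Lemma mpow0 F : mpow 0 F = F [::].
Proof. by []. Qed.

Lemma mpow_nth a0 n j (g : A -> R) : (j < n)%N ->
  mpow n (fun s => g (nth a0 s j)) = M g.
Proof.
elim: n j => [|n IH] [|j] // jn; rewrite mpowS.
  by congr (M _); apply/funext => a; exact: (mean_cst (mpow n) (g a)).
by rewrite -[RHS](mean_cst M); congr (M _); apply/funext => a; exact: IH.
Qed.

Lemma mpow_nthM a0 n j k (g h : A -> R) :
  (j < n)%N -> (k < n)%N -> j != k ->
  mpow n (fun s => g (nth a0 s j) * h (nth a0 s k)) = M g * M h.
Proof.
elim: n j k => [|n IH] [|j] [|k] // jn kn jk; rewrite mpowS.
- rewrite -meanZr; congr (M _); apply/funext => a.
  by rewrite -(@mpow_nth a0 n k h kn); exact: (meanZ (mpow n) (g a)).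
- rewrite -meanZ; congr (M _); apply/funext => a.
  rewrite -(@mpow_nth a0 n j g jn); exact: (meanZr (mpow n) (h a)).
- by rewrite -[RHS](mean_cst M); congr (M _); apply/funext => a; exact: IH.
Qed.

End Power.

End Mean.

(** * A weak law of large numbers *)

Section LawOfLargeNumbers.
Variables (R : realType) (O : Type) (M : mean R O) (n : nat).
Variables (x : 'I_n.+1 -> O -> R) (e V : R).
Hypothesis xM : forall j, M (x j) = e.
Hypothesis xMM : forall j k, j != k -> M (fun o => x j o * x k o) = e ^+ 2.
Hypothesis xV : forall j, M (fun o => x j o ^+ 2) <= V.

Let S o := n.+1%:R^-1 * \sum_(j < n.+1) x j o.

(** Off-diagonal products in the square of the sum contribute [e ^+ 2], and only n + 1 of the (n +
    1)^2 products are diagonal. Centering at 1 instead of the mean [e] costs (1 - e)^2. *)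
Lemma variance_average : M (fun o => (S o - 1) ^+ 2) <= V / n.+1%:R + (1 - e) ^+ 2.
Proof.
have n0 : n.+1%:R != 0 :> R by rewrite pnatr_eq0.
have MS : M S = e.
  rewrite /S meanZ mean_sum (eq_bigr (fun=> e)) => [|j _]; last exact: xM.
  by rewrite sumr_const card_ord -[e *+ _]mulr_natl mulrA mulVf // mul1r.
have MSS : M (fun o => S o ^+ 2) <= V / n.+1%:R + e ^+ 2.
  have -> : (fun o => S o ^+ 2) = (fun o => n.+1%:R^-1 ^+ 2 *
      \sum_(j < n.+1) \sum_(k < n.+1) x j o * x k o).
    apply/funext => o; rewrite /S exprMn; congr (_ * _).
    by rewrite expr2 mulr_suml; apply: eq_bigr => j _; rewrite mulr_sumr.
  rewrite meanZ mean_sum.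
  apply: (@le_trans _ _ (n.+1%:R^-1 ^+ 2 *
      \sum_(j < n.+1) \sum_(k < n.+1) (e ^+ 2 + (j == k)%:R * V))).
    rewrite ler_wpM2l ?sqr_ge0 // ler_sum // => j _; rewrite mean_sum ler_sum // => k _.
    have [<-|jk] := eqVneq j k; last by rewrite xMM // mul0r addr0.
    rewrite mul1r; apply: (le_trans (xV j)).
    by rewrite lerDr sqr_ge0.
  rewrite (eq_bigr (fun=> n.+1%:R * e ^+ 2 + V)) => [|j _].
    rewrite sumr_const card_ord -[X in _ * X <= _]mulr_natl le_eqVlt; apply/orP; left; apply/eqP.
    by move: (n.+1%:R : R) n0 => N N0; field.
  rewrite big_split /= sumr_const card_ord mulr_natl -mulr_suml; congr (_ + _).
  rewrite (bigD1 j) //= eqxx big1 ?addr0 ?mul1r // => k kj.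
  by rewrite eq_sym (negbTE kj).
have -> : (fun o => (S o - 1) ^+ 2) = (fun o => S o ^+ 2 + (1 - 2 * S o)).
  by apply/funext => o; ring.
rewrite meanD meanB mean_cst meanZ MS.
have -> : V / n.+1%:R + (1 - e) ^+ 2 = V / n.+1%:R + e ^+ 2 + (1 - 2 * e) by ring.
by rewrite lerD2r.
Qed.

Variable T : 'I_n.+1 -> O -> O.
Hypothesis xT : forall j F, (forall o, 0 <= F o) ->
  M (fun o => x j o * F o) <= M (fun o => F (T j o)).

(* Only the lower bound [xT] is assumed; the upper bound comes from applying it to
   [C - F], since the average of the weights has mean close to 1. *)
Lemma average_nearly_invariant F C eps :
  0 <= C -> 0 < eps -> V / n.+1%:R + (1 - e) ^+ 2 <= eps ^+ 2 ->
  (forall o, `|F o| <= C) ->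
  `|n.+1%:R^-1 * \sum_(j < n.+1) M (fun o => F (T j o)) - M F| <= 2 * C * eps.
Proof.
move=> C0 e0 Ve FC.
have SF : M (fun o => `|S o - 1|) <= eps.
  by apply: mean_norm_sqr => //; apply: le_trans Ve; exact: variance_average.
have avgC : n.+1%:R^-1 * \sum_(j < n.+1) C = C.
  by rewrite sumr_const card_ord -[C *+ _]mulr_natl mulrA mulVf ?mul1r // pnatr_eq0.
(* The shift by C makes [F' + C] nonnegative, as [xT] requires, and adds C to both sides. *)
have half F' : (forall o, `|F' o| <= C) ->
    M F' - 2 * C * eps <= n.+1%:R^-1 * \sum_(j < n.+1) M (fun o => F' (T j o)).
  move=> F'C; have FC0 o : 0 <= F' o + C.
    by move: (F'C o); rewrite ler_norml => /andP[? _]; lra.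
  rewrite -(lerD2r C) -[X in _ <= _ + X]avgC -mulrDr -big_split /=.
  apply: (@le_trans _ _ (M (fun o => S o * (F' o + C)))); last first.
    have -> : (fun o => S o * (F' o + C)) = (fun o => n.+1%:R^-1 *
        \sum_(j < n.+1) x j o * (F' o + C)).
      by apply/funext => o; rewrite -mulrA mulr_suml.
    rewrite meanZ mean_sum ler_wpM2l ?invr_ge0 // ler_sum // => j _.
    by rewrite -[X in _ <= _ + X](mean_cst M) -meanD; exact: xT.
  (* Since 0 <= F' + C <= 2C, replacing the weight [S] by 1 costs at most 2C |S - 1|. *)
  apply: (@le_trans _ _ (M (fun o => (F' o + C) - 2 * C * `|S o - 1|))).
    rewrite meanB meanZ meanD mean_cst.
    have : 2 * C * M (fun o => `|S o - 1|) <= 2 * C * eps.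
      by rewrite ler_wpM2l // mulr_ge0.
    lra.
  apply: le_mean => o; rewrite -subr_ge0.
  have -> : S o * (F' o + C) - (F' o + C - 2 * C * `|S o - 1|) =
    (S o - 1) * (F' o + C) + 2 * C * `|S o - 1| by ring.
  suff : - ((S o - 1) * (F' o + C)) <= 2 * C * `|S o - 1| by lra.
  apply: (le_trans (ler_norm _)); rewrite normrN normrM mulrC.
  rewrite ler_wpM2r // ger0_norm //.
  by move: (F'C o); rewrite ler_norml => /andP[_ ?]; lra.
rewrite ler_norml; apply/andP; split.
  by rewrite lerBrDr addrC; exact: half.
have := half (fun o => - F o); rewrite meanN.
have -> : \sum_(j < n.+1) M (fun o => - F (T j o)) = - \sum_(j < n.+1) M (fun o => F (T j o)).
  by rewrite -sumrN; apply: eq_bigr => j _; rewrite -meanN.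
rewrite mulrN => H.
have : - M F - 2 * C * eps <= - (n.+1%:R^-1 * \sum_(j < n.+1) M (fun o => F (T j o))).
  by apply: H => o; rewrite normrN.
by rewrite lerNr opprB opprK lerBlDr.
Qed.

End LawOfLargeNumbers.

(** * Densities on independent samples *)

Section Insertion.
Variables (R : realType) (A : Type) (a0 : A) (M : mean R A).

Lemma mpow_set_nth (c : A -> A) (r : A -> R) n j F :
  (forall G, (forall a, 0 <= G a) ->
     M (fun a => r a * G a) <= M (fun a => G (c a))) ->
  (j < n)%N -> (forall s, 0 <= F s) ->
  mpow M n (fun s => r (nth a0 s j) * F s) <=
  mpow M n (fun s => F (set_nth a0 s j (c (nth a0 s j)))).
Proof.
move=> cr; elim: n j F => [|n IH] [|j] F // jn F0; rewrite !mpowS /=.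
  have -> : (fun a => mpow_fun M n (fun s => r a * F (a :: s))) =
      (fun a => r a * mpow M n (fun s => F (a :: s))).
    by apply/funext => a; rewrite -meanZ.
  by apply: (cr (fun a => mpow M n (fun s => F (a :: s)))) => a; exact: mean_ge0.
by apply: le_mean => a; apply: (IH _ (fun s => F (a :: s))).
Qed.

Variables (H : Type) (c : H -> A -> A) (r : H -> A -> R) (P : H -> Prop).
Hypothesis r0 : forall h a, 0 <= r h a.
Hypothesis cr : forall h, P h -> forall G, (forall a, 0 <= G a) ->
     M (fun a => r h a * G a) <= M (fun a => G (c h a)).

(** Independence makes densities multiply: this is the candidate density for the law of [act2 hs],
    one factor per sample. *)
Definition weight (hs : seq H) (s : seq A) : R := \prod_(p <- zip hs s) r p.1 p.2.
Definition act2 (hs : seq H) (s : seq A) : seq A := [seq c p.1 p.2 | p <- zip hs s].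

Lemma mpow_act2 hs F : (forall i, (i < size hs)%N -> forall h0, P (nth h0 hs i)) ->
  (forall s, 0 <= F s) ->
  mpow M (size hs) (fun s => weight hs s * F s) <=
  mpow M (size hs) (fun s => F (act2 hs s)).
Proof.
elim: hs F => [|h hs IH] F Phs F0 /=.
  by rewrite /weight big_nil mul1r.
have -> : (fun a => mpow_fun M (size hs) (fun s => weight (h :: hs) (a :: s) * F (a :: s))) =
      (fun a => r h a * mpow M (size hs) (fun s => weight hs s * F (a :: s))).
  apply/funext => a; rewrite -meanZ; congr (mpow_fun _ _ _); apply/funext => s.
  by rewrite /weight /= big_cons mulrA.
have Ph : P h by exact: (Phs 0%N (ltn0Sn _) h).
apply: (@le_trans _ _ (M (fun a => mpow M (size hs) (fun s => weight hs s * F (c h a :: s))))).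
  apply: (cr Ph (G := fun a => mpow M (size hs) (fun s => weight hs s * F (a :: s)))) => a.
  by apply: mean_ge0 => s; rewrite mulr_ge0 // /weight prodr_ge0.
by apply: le_mean => a; apply: IH => // i ih; exact: (Phs i.+1).
Qed.

End Insertion.

Lemma mpow_prod (R : realType) (A H : Type) (M : mean R A) (g : H -> A -> R) (hs : seq H) :
  mpow M (size hs) (fun s => \prod_(p <- zip hs s) g p.1 p.2) = \prod_(h <- hs) M (g h).
Proof.
elim: hs => [|h hs IH] /=; first by rewrite !big_nil.
rewrite big_cons -IH -meanZr; congr (M _); apply/funext => a; rewrite -meanZ.
by congr (mpow_fun _ _ _); apply/funext => s; rewrite big_cons.
Qed.

(** Used with t = 1 / (n + 1): it bounds the mass lost over p independent samples. *)
Lemma bernoulli_ineq (R : realFieldType) (t : R) p : 0 <= t <= 1 ->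
  0 <= 1 - (1 - t) ^+ p <= p%:R * t.
Proof.
move=> /andP[t0 t1]; elim: p => [|p /andP[IH1 IH2]].
  by rewrite expr0 subrr mul0r lexx.
have p1 : 0 <= (1 - t) ^+ p by rewrite exprn_ge0 // subr_ge0.
rewrite exprS -natr1; move: ((1 - t) ^+ p) IH1 IH2 p1 => y *.
apply/andP; split; nra.
Qed.

Lemma prodr_const_size (R : comNzRingType) (H : eqType) (c : R) (s : seq H) :
  \prod_(h <- s) c = c ^+ size s.
Proof. by elim: s => [|h s IH]; rewrite ?big_nil // big_cons IH exprS. Qed.

(** * Random words over a finite alphabet *)

Section Words.
Variables (R : realType) (G : eqType) (e0 : G) (E' : seq G).
Let E := e0 :: E'.
Hypothesis Euniq : uniq E.

Definition muniform : mean R G :=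
  mean_avg (fun i : 'I_(size E').+1 => mean_dirac R (nth e0 E i)).

(** The factor [(size E)%:R * (e == h)%:R] is the density of the Dirac mass at h against the uniform
    law, because E has no repetition. *)
Lemma muniform_delta h (g : G -> R) : h \in E ->
  muniform (fun e => (size E)%:R * (e == h)%:R * g e) = g h.
Proof.
move=> hE; rewrite /muniform /=.
have -> : \sum_(i < (size E').+1) (size E)%:R * (nth e0 E i == h)%:R * g (nth e0 E i) =
  \sum_(e <- E) (size E)%:R * (e == h)%:R * g e.
  by rewrite (big_nth e0) big_mkord.
rewrite (bigD1_seq h) //= eqxx mulr1 big1 ?addr0 => [|e /negbTE->]; last by rewrite mulr0 mul0r.
by rewrite mulrA mulVf ?mul1r // pnatr_eq0.
Qed.

(** The length is uniform in 0, ..., J, so that the shift of the length caused by a prepended letter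
    disturbs only a mass of 1 / (J + 1). *)
Definition mword J : mean R (seq G) :=
  mean_avg (fun j : 'I_J.+1 => mpow muniform j).

(* Up to the boundary effect at length J, the density of the image of [mword J]
   under [cons h]. *)
Definition density h (w : seq G) : R :=
  if w is e :: _ then (size E)%:R * (e == h)%:R else 0.

Lemma density_ge0 h w : 0 <= density h w.
Proof. by case: w => [|e w] //=; rewrite mulr_ge0. Qed.

Lemma mpow_density h j F : h \in E ->
  mpow muniform j.+1 (fun w => density h w * F w) = mpow muniform j (fun w => F (h :: w)).
Proof.
move=> hE; rewrite mpowS.
rewrite -(muniform_delta (fun e => mpow muniform j (fun w => F (e :: w))) hE).
by congr (muniform _); apply/funext => e; rewrite -meanZ.
Qed.

Lemma mword_density J h F : h \in E ->
  mword J (fun w => density h w * F w) =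
  J.+1%:R^-1 * \sum_(j < J) mpow muniform j (fun w => F (h :: w)).
Proof.
move=> hE; rewrite /mword; congr (_ * _).
rewrite big_ord_recl [X in X + _ = _](_ : _ = 0) ?add0r; last by rewrite /= mul0r.
by apply: eq_bigr => j _; rewrite -mpow_density.
Qed.

(** The right side has one more term, from the words of length J, and it is nonnegative. *)
Lemma mword_cons_ge J h F : h \in E -> (forall w, 0 <= F w) ->
  mword J (fun w => density h w * F w) <= mword J (fun w => F (h :: w)).
Proof.
move=> hE F0; rewrite mword_density // ler_wpM2l ?invr_ge0 //.
by rewrite big_ord_recr /= lerDl; apply: (mean_ge0 (mpow muniform J)).
Qed.

Lemma mword_density1 J h : h \in E -> mword J (density h) = J%:R / J.+1%:R.
Proof.
move=> hE; have := mword_density J (fun=> 1) hE.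
have -> : (fun w => density h w * 1) = density h by apply/funext => w; rewrite mulr1.
move=> ->; rewrite (eq_bigr (fun=> 1)) => [|j _]; last exact: mean1.
by rewrite sumr_const card_ord mulrC.
Qed.

Lemma mword_density2 J h : h \in E ->
  mword J (fun w => density h w ^+ 2) <= (size E)%:R.
Proof.
move=> hE; rewrite (mword_density J (density h)) //= eqxx mulr1.
rewrite (eq_bigr (fun=> (size E)%:R)) => [|j _]; last exact: (mean_cst (mpow muniform j)).
rewrite sumr_const card_ord -[_ *+ J]mulr_natr mulrCA ler_piMr //.
by rewrite mulrC ler_pdivrMr // mul1r ler_nat.
Qed.

(** Models left multiplication of a configuration by the conjugate of h by t_j, as [config_insert]
    shows. *)
Definition insert_letter (j : nat) (h : G) (th : seq (seq G)) :=
  set_nth [::] th j (h :: nth [::] th j).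

(** For each j the weight multiplies the densities of the j-th words of the p samples: its mean is
    (n / (n + 1))^p, distinct j are uncorrelated, and its second moment is at most |E|^p. One n
    controls both the length and the number of words, uniformly in [hs] and [F]. *)
Lemma words_nearly_invariant p (C eps : R) : 0 <= C -> 0 < eps ->
  exists n, forall hs (F : seq (seq (seq G)) -> R), size hs = p -> {subset hs <= E} ->
  (forall s, `|F s| <= C) ->
  let M := mpow (mpow (mword n) n.+1) p in
  `|n.+1%:R^-1 * \sum_(j < n.+1) M (fun s => F (act2 (insert_letter j) hs s)) - M F| <= eps.
Proof.
(* The final error is [2 * C * eps']; the added 1 keeps the denominator positive when C = 0. *)
move=> C0 eps0; pose eps' := eps / (2 * C + 1).
have eps'0 : 0 < eps' by rewrite divr_gt0 //; lra.
pose m := (size E)%:R : R; have m0 : 0 <= m by exact: ler0n.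
(* Large enough that (m^p + p^2) / (n + 1) <= eps'^2, which covers the variance and the squared
   defect (1 - e)^2. *)
pose n := (Num.bound ((m ^+ p + p%:R ^+ 2) / eps' ^+ 2)).
exists n => hs F hsp hsE FC; set M := mpow _ _.
pose e : R := (n%:R / n.+1%:R) ^+ p.
have xM h j : h \in E -> (j < n.+1)%N -> 
    mpow (mword n) n.+1 (fun th => density h (nth [::] th j)) = n%:R / n.+1%:R.
  by move=> hE jn; rewrite mpow_nth // mword_density1.
pose x (j : 'I_n.+1) := weight (fun h th => density h (nth [::] th j)) hs.
pose T (j : 'I_n.+1) := act2 (insert_letter j) hs.
have t0 : 0 <= (n.+1%:R^-1 : R) <= 1.
  by rewrite invr_ge0 ler0n invf_le1 ?ltr0n // ler1n.
have e1 : 0 <= 1 - e <= p%:R * n.+1%:R^-1.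
  have -> : e = (1 - n.+1%:R^-1) ^+ p.
    by rewrite /e -natr1; congr (_ ^+ _); field; rewrite natr1 pnatr_eq0.
  exact: bernoulli_ineq.
have H : m ^+ p / n.+1%:R + (1 - e) ^+ 2 <= eps' ^+ 2.
  apply: (@le_trans _ _ ((m ^+ p + p%:R ^+ 2) / n.+1%:R)).
    rewrite mulrDl lerD2l; apply: (@le_trans _ _ ((p%:R * n.+1%:R^-1) ^+ 2)).
      by case/andP: e1 => ? ?; rewrite lerXn2r // nnegrE mulr_ge0 // invr_ge0.
    rewrite exprMn ler_wpM2l ?sqr_ge0 //; case/andP: t0 => ? ?.
    by rewrite expr2 ler_piMr.
  rewrite ler_pdivrMr // mulrC -ler_pdivrMr ?exprn_gt0 //.
  have mp0 : 0 <= (m ^+ p + p%:R ^+ 2) / eps' ^+ 2.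
    by rewrite divr_ge0 ?sqr_ge0 // addr_ge0 ?sqr_ge0 ?exprn_ge0.
  apply: ltW; apply: (lt_le_trans (archi_boundP mp0)).
  by rewrite ler_nat leqnSn.
have main : `|n.+1%:R^-1 * \sum_(j < n.+1) M (fun s => F (T j s)) - M F| <= 2 * C * eps'.
  apply: (@average_nearly_invariant R _ M n x e (m ^+ p)) => //.
  - move=> j; rewrite /x /weight /M /e -hsp (mpow_prod _ (fun h th => density h (nth [::] th j))).
    rewrite -(prodr_const_size (n%:R / n.+1%:R)).
    by rewrite !big_seq; apply: eq_bigr => h /hsE hE; exact: xM.
  - move=> j k jk; rewrite /x /weight /M /e -hsp.
    have -> : (fun s => (\prod_(q <- zip hs s) density q.1 (nth [::] q.2 j)) *
       \prod_(q <- zip hs s) density q.1 (nth [::] q.2 k)) =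
       (fun s => \prod_(q <- zip hs s)
         (density q.1 (nth [::] q.2 j) * density q.1 (nth [::] q.2 k))).
      by apply/funext => s; rewrite big_split.
    rewrite (mpow_prod _ (fun h th => density h (nth [::] th j) * density h (nth [::] th k))).
    rewrite -exprM mulnC exprM -(prodr_const_size ((n%:R / n.+1%:R) ^+ 2)).
    rewrite !big_seq; apply: eq_bigr => h /hsE hE.
    by rewrite mpow_nthM // mword_density1.
  - move=> j; rewrite /x /weight /M -hsp.
    have -> : (fun s => (\prod_(q <- zip hs s) density q.1 (nth [::] q.2 j)) ^+ 2) =
       (fun s => \prod_(q <- zip hs s) (density q.1 (nth [::] q.2 j) ^+ 2)).
      by apply/funext => s; rewrite -prodrXl.
    rewrite (mpow_prod _ (fun h th => density h (nth [::] th j) ^+ 2)).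
    rewrite -(prodr_const_size m) !big_seq; apply: ler_prod => h /hsE hE.
    rewrite mean_ge0 => [|th]; last exact: sqr_ge0.
    rewrite (mpow_nth _ _ (fun w => density h w ^+ 2)) //.
    exact: mword_density2.
  - move=> j F' F'0; rewrite /M -hsp; apply: (mpow_act2 (P := fun h => h \in E)) => //.
    + by move=> h a; exact: density_ge0.
    + move=> h hE F'' F''0; apply: (@mpow_set_nth _ _ [::] _ (cons h)) => // F3 F30.
      exact: mword_cons_ge.
    + by move=> i ih h0; apply: hsE; exact: mem_nth.
apply: (le_trans main); rewrite /eps' mulrA ler_pdivrMr; last by lra.
by rewrite mulrC ler_wpM2l ?ltW //; lra.
Qed.

End Words.

(** * Generalized limits *)

Section GeneralizedLimit.
Local Open Scope classical_set_scope.
Variables (R : realType) (I : Type).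

Definition bounded_family (u : I -> R) := exists C, forall i, `|u i| <= C.

Record is_glim (F : set_system I) (Lim : (I -> R) -> R) : Prop := IsGlim {
  glimB : forall u v, bounded_family u -> bounded_family v ->
    Lim (fun i => u i - v i) = Lim u - Lim v;
  glim_cst : forall c, Lim (fun=> c) = c;
  glim_norm_le : forall u C, bounded_family u ->
    F [set i | `|u i| <= C] -> `|Lim u| <= C }.

Lemma ultra_fmap (T : Type) (f : I -> T) (F : set_system I) :
  UltraFilter F -> UltraFilter (f @ F).
Proof.
move=> UF; split; first exact: fmap_proper_filter.
move=> H HF sub; apply/seteqP; split=> [A HA|]; last exact: sub.
have [//|/(sub (~` A)) HnA] := in_ultra_setVsetC (f @^-1` A) UF.
by have /filter_ex [? []] : H (A `&` ~` A) by exact: filterI.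
Qed.

(** Refine F to an ultrafilter: a bounded family takes its values in a compact segment, so it
    converges along the ultrafilter. *)
Lemma glim_exists (F : set_system I) : ProperFilter F -> exists Lim, is_glim F Lim.
Proof.
move=> FF; have [U [UU FU]] := ultraFilterLemma FF.
have cvgU u : bounded_family u -> cvg (u @ U).
  move=> [C uC]; have := @segment_compact R (- C) C; rewrite compact_ultra.
  have UuU := ultra_fmap u UU.
  move=> /(_ (u @ U) UuU) [|l [_ ul]]; last by apply/cvg_ex; exists l.
  rewrite (_ : (u @ U) _ = U setT); first exact: filterT.
  congr U; apply/seteqP; split=> // i _.
  by rewrite /= in_itv /=; move: (uC i); rewrite ler_norml.
exists (fun u => lim (u @ U)); split.
- by move=> u v /cvgU cu /cvgU cv; apply: limB.
- by move=> c; apply: cvg_lim; [exact: Rhausdorff | exact: cvg_cst].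
- move=> u C bu uC; have cu := cvgU u bu.
  have UC : U [set i | `|u i| <= C] by exact: FU.
  rewrite ler_norml; apply/andP; split.
    apply: limr_ge => //; apply: filterS UC => i /=.
    by rewrite ler_norml => /andP[].
  apply: limr_le => //; apply: filterS UC => i /=.
  by rewrite ler_norml => /andP[].
Qed.

Lemma bounded_familyB u v : bounded_family u -> bounded_family v ->
  bounded_family (fun i => u i - v i).
Proof.
move=> [C uC] [D vD]; exists (C + D) => i.
by apply: (le_trans (ler_normB _ _)); apply: lerD.
Qed.

Lemma bounded_family_cst c : bounded_family (fun=> c).
Proof. by exists `|c|. Qed.

Variables (F : set_system I) (Lim : (I -> R) -> R).
Hypothesis FF : ProperFilter F.
Hypothesis LimP : is_glim F Lim.

Lemma glim_eq u v : bounded_family u -> bounded_family v ->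
  F [set i | u i = v i] -> Lim u = Lim v.
Proof.
move=> bu bv uv; apply/eqP; rewrite -subr_eq0 -normr_le0 -(glimB LimP) //.
apply: (glim_norm_le LimP); first exact: bounded_familyB.
by apply: filterS uv => i /= ->; rewrite subrr normr0.
Qed.

Lemma glim_eq_cst u c : bounded_family u -> F [set i | u i = c] -> Lim u = c.
Proof.
by move=> bu uc; rewrite -[RHS](glim_cst LimP); apply: glim_eq => //; exact: bounded_family_cst.
Qed.

Lemma glim_sdiff (T : eqType) (b : I -> seq T -> R) s :
  (forall u, exists C, forall i, `|b i u| <= C) ->
  sdiff (fun u => Lim (b^~ u)) s = Lim (fun i => sdiff (b i) s) /\
  bounded_family (fun i => sdiff (b i) s).
Proof.
elim: s b => [|y s IH] b bC /=.
  by split; [rewrite (glim_cst LimP) | exact: bounded_family_cst].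
have [|-> bs] := IH (fun i u => b i (y :: u)); first by move=> u; exact: bC.
by split; [rewrite (glimB LimP) //; exact: bC | apply: bounded_familyB => //; exact: bC].
Qed.

End GeneralizedLimit.

(** * The prism operator of a random map *)

Section Prism.
Variables (R : realType) (T T' : eqType) (O : Type) (M : mean R O).
Variables (alpha : T -> T') (beta : O -> T -> T').
Implicit Types (f : seq T' -> R) (s : seq T).

(* The expectation of [f] on the image of [s], where each entry of [s] is mapped
   by an independent sample of [beta]. *)
Fixpoint prand f s : R :=
  if s is y :: s' then M (fun o => prand (fun u => f (beta o y :: u)) s')
  else f [::].

(** With y_0, ..., y_n the entries, this is the sum of (-1)^i f(alpha y_0, ..., alpha y_i, beta y_i,
    ..., beta y_n) averaged over independent samples; the recursion splits off i = 0. *)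
Fixpoint prism f s : R :=
  if s is y :: s' then
    M (fun o => prand (fun u => f (alpha y :: beta o y :: u)) s')
      - prism (fun u => f (alpha y :: u)) s'
  else 0.

Lemma prandE f s : prand f s =
  mpow M (size s) (fun os => f [seq beta p.2 p.1 | p <- zip s os]).
Proof.
elim: s f => [|y s IH] f //=; congr (M _); apply/funext => o; exact: IH.
Qed.

Lemma prandB f g s : prand (fun u => f u - g u) s = prand f s - prand g s.
Proof. by rewrite !prandE meanB. Qed.

Lemma prand_norm_le f s C :
  (forall u, `|f u| <= C) -> `|prand f s| <= C.
Proof. by move=> fC; rewrite prandE; apply: mean_norm_le. Qed.

Lemma eq_prand f g s : (forall u, size u = size s -> f u = g u) ->
  prand f s = prand g s.
Proof.
elim: s f g => [|y s IH] f g fg /=; first exact: fg.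
congr (M _); apply/funext => o; apply: IH => u us.
by apply: fg; rewrite /= us.
Qed.

(** The sample of a deleted vertex integrates out, so a face of the random image has the law of the
    random image of the face. *)
Lemma prand_sdiff f s : sdiff (prand f) s = prand (sdiff f) s.
Proof.
elim: s f => [|y s IH] f //=.
rewrite (sdiff_mean M (fun o => prand (fun v => f (beta o y :: v)))).
under [in RHS]eq_fun do rewrite prandB.
rewrite meanB mean_cst; congr (_ - M _); apply/funext => o; exact: IH.
Qed.

Lemma prismB f g s : prism (fun u => f u - g u) s = prism f s - prism g s.
Proof.
elim: s f g => [|y s IH] f g /=; first by rewrite subrr.
rewrite IH; under eq_fun do rewrite prandB.
rewrite meanB; ring.
Qed.

Lemma prism_homotopy f s :
  sdiff (prism f) s + prism (sdiff f) s = prand f s - f (map alpha s).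
Proof.
elim: s f => [|y s IH] f /=; first by rewrite addr0 subrr.
set fy := fun u => f (alpha y :: u); pose h o v := f (alpha y :: beta o y :: v).
have E1 : sdiff (fun u => M (fun o => prand (h o) u) - prism fy u) s =
    M (fun o => prand (sdiff (h o)) s) - sdiff (prism fy) s.
  rewrite sdiffB (sdiff_mean M (fun o => prand (h o))); congr (M _ - _).
  by apply/funext => o; rewrite prand_sdiff.
(* Deleting [alpha y] yields the first term of [prand f], deleting [beta o y] a term in [fy]; the
   remaining faces cancel against those in [E1]. *)
have E2 : M (fun o => prand (fun u => f (beta o y :: u) - (fy u - sdiff (h o) u)) s) =
    M (fun o => prand (fun u => f (beta o y :: u)) s) -
      (prand fy s - M (fun o => prand (sdiff (h o)) s)).
  rewrite -[prand fy s](mean_cst M) -!meanB; congr (M _); apply/funext => o.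
  by rewrite -!prandB.
have -> : f (alpha y :: map alpha s) =
    prand fy s - (sdiff (prism fy) s + prism (sdiff fy) s) by rewrite IH opprB addrC subrK.
rewrite E1 E2 prismB; ring.
Qed.

Lemma eq_prism f g s : (forall u, size u = (size s).+1 -> f u = g u) ->
  prism f s = prism g s.
Proof.
elim: s f g => [|y s IH] f g fg //=; congr (_ - _).
  congr (M _); apply/funext => o; apply: eq_prand => u us.
  by apply: fg; rewrite /= us.
by apply: IH => u us; apply: fg; rewrite /= us.
Qed.

Lemma prism_norm_le f s C : (forall u, `|f u| <= C) ->
  `|prism f s| <= (size s)%:R * C.
Proof.
move=> fC; elim: s f fC => [|y s IH] f fC /=; first by rewrite normr0 mul0r.
apply: (le_trans (ler_normB _ _)); rewrite -natr1 mulrDl mul1r addrC.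
apply: lerD; first by apply: IH => u; exact: fC.
by apply: mean_norm_le => o; apply: prand_norm_le => u; exact: fC.
Qed.

Lemma prand_map (g : T -> T) (h : T' -> T') f s :
  (forall o y, beta o (g y) = h (beta o y)) ->
  prand f (map g s) = prand (fun u => f (map h u)) s.
Proof.
move=> bg; elim: s f => [|y s IH] f //=; congr (M _); apply/funext => o.
by rewrite IH bg.
Qed.

Lemma prism_map (g : T -> T) (h : T' -> T') f s :
  (forall y, alpha (g y) = h (alpha y)) ->
  (forall o y, beta o (g y) = h (beta o y)) ->
  prism f (map g s) = prism (fun u => f (map h u)) s.
Proof.
move=> ag bg; elim: s f => [|y s IH] f //=; rewrite IH ag; congr (M _ - _).
by apply/funext => o; rewrite (prand_map _ _ bg) bg.
Qed.

End Prism.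

(** * Commuting conjugates imply bounded acyclicity *)

Section CommutingConjugates.
Local Open Scope group_scope.
Variable G : groupType.

Definition is_subgroup (L : G -> Prop) : Prop :=
  [/\ L 1, forall x y, L x -> L y -> L (x * y) & forall x, L x -> L x^-1].

Definition conjugate (t x : G) : G := t * x * t^-1.

Definition commuting_conjugates (L : G -> Prop) : Prop :=
  forall E : seq G, (forall e, e \in E -> L e) ->
  exists t : nat -> G, (forall j, L (t j)) /\
    forall j k e e', j != k -> e \in E -> e' \in E ->
      commute (conjugate (t j) e) (conjugate (t k) e').

Lemma conjugateM t x y : conjugate t (x * y) = conjugate t x * conjugate t y.
Proof. by rewrite /conjugate -!mulgA mulKg. Qed.

Lemma conjugate1 t : conjugate t 1 = 1.
Proof. by rewrite /conjugate mulg1 mulgV. Qed.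

(** Choose a representative in each right coset of L and divide by it on the right. The retraction
    supplies letters in L for arbitrary vertices in G. *)
Lemma coset_retraction (L : G -> Prop) : is_subgroup L ->
  exists2 r : G -> G, forall g, L (r g) & forall l g, L l -> r (l * g) = l * r g.
Proof.
move=> [L1 LM LV]; pose C g : set G := [set h | L (g * h^-1)]%classic.
have Cg g : (C g !=set0)%classic by exists g; rewrite /C /= mulgV.
have CL l g : L l -> C (l * g) = C g.
  move=> Ll; apply/funext => h; apply/propext; rewrite /C /= -mulgA; split=> H; last exact: LM.
  by rewrite -[_ * _](mulKg l); apply: LM => //; exact: LV.
exists (fun g => g * (xget 1 (C g))^-1) => [g|l g Ll].
  exact: (xgetPex 1 (Cg g)).
by rewrite CL // mulgA.
Qed.

(* Words are read with the letters outside [E] deleted, so that [config] depends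
   on elements of [E] only. *)
Variable E : seq G.

Definition letter (e : G) : G := if e \in E then e else 1.

Definition word (w : seq G) : G := foldr (fun e x => letter e * x) 1 w.

Fixpoint config (t : nat -> G) (th : seq (seq G)) : G :=
  if th is w :: th' then conjugate (t 0%N) (word w) * config (t \o S) th' else 1.

Lemma commute_word t t' e w :
  (forall e', e' \in E -> commute (conjugate t e) (conjugate t' e')) ->
  commute (conjugate t e) (conjugate t' (word w)).
Proof.
move=> tt'; elim: w => [|e' w IH] /=; first by rewrite conjugate1; exact: commute1.
rewrite conjugateM; apply: commuteM => //; rewrite /letter; case: ifP => [/tt'//|_].
by rewrite conjugate1; exact: commute1.
Qed.

Lemma config_insert (t : nat -> G) h j th : h \in E ->
  (forall j k e e', j != k -> e \in E -> e' \in E ->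
      commute (conjugate (t j) e) (conjugate (t k) e')) ->
  config t (insert_letter j h th) = conjugate (t j) h * config t th.
Proof.
move=> hE; elim: j th t => [|j IH] [|w th] t tC.
- by rewrite /insert_letter /= /letter hE conjugateM conjugate1 !mulg1.
- by rewrite /insert_letter /= /letter hE conjugateM -mulgA.
(* [set_nth] pads a short list with empty words, whose conjugates are trivial. *)
- have := IH [::] (t \o S); rewrite /insert_letter /= nth_nil !set_nth_nil /= => ->.
    by rewrite conjugate1 mul1g.
  by move=> i k e e1 ik eE e1E; exact: tC.
have := IH th (t \o S); rewrite /insert_letter /= => ->;
  last by move=> i k e e' ik eE e'E; exact: tC.
have cw : commute (conjugate (t j.+1) h) (conjugate (t 0%N) (word w)).
  by apply: commute_word => e' e'E; exact: tC.
by rewrite [LHS]mulgA -cw -[LHS]mulgA.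
Qed.

End CommutingConjugates.

(** * Primitives of bounded cocycles by averaging *)

Section Acyclicity.
Variables (R : realType) (G : groupType) (L : G -> Prop).
Hypothesis Lgroup : is_subgroup L.
Hypothesis LC : commuting_conjugates L.

Variables (f : seq G -> R) (p : nat) (C : R).
Hypothesis fC : forall s, `|f s| <= C.
Hypothesis fL : forall l s, L l -> f (map ( *%g l) s) = f s.
Hypothesis fcocycle : forall s, size s = p.+1 -> sdiff f s = 0.

Variable r : G -> G.
Hypothesis rL : forall g, L (r g).
Hypothesis rM : forall l g, L l -> r (l * g)%g = (l * r g)%g.

(* The prism operator between [y |-> t_j y], along which [f] is invariant, and the random
   equivariant map [beta], averaged over j. *)
Lemma approximate_primitive (E : seq G) (eps : R) :
  (forall e, e \in E -> L e) -> 0 < eps ->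
  exists b : (seq G -> R) * R,
  [/\ forall l s, L l -> b.1 (map ( *%g l) s) = b.1 s,
      forall s, `|b.1 s| <= (size s)%:R * C,
      `|b.2| <= C &
      forall s, size s = p -> (forall y, y \in s -> r y \in E) ->
        `|sdiff b.1 s + f s - b.2| <= eps].
Proof.
(* [1 :: E'] enumerates E and 1 without repetition, in the form that the random words need. *)
move=> EL eps0; pose E' := rem 1%g (undup (1%g :: E)).
have perm : perm_eq (undup (1%g :: E)) (1%g :: E').
  by apply: perm_to_rem; rewrite mem_undup mem_head.
have E'u : uniq (1%g :: E') by rewrite -(perm_uniq perm) undup_uniq.
have E'E : (1%g :: E') =i 1%g :: E by move=> e; rewrite -(perm_mem perm) mem_undup.
have C0 : 0 <= C by apply: le_trans (fC [::]).
have EL1 e : e \in 1%g :: E' -> L e.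
  by rewrite E'E inE => /predU1P[->|/EL//]; case: Lgroup.
have [t [tL tC]] := LC EL1.
have [n nP] := words_nearly_invariant E'u p C0 eps0.
set M1 := mpow (mword R 1%g E' n) n.+1 in nP.
(* Both [alpha j] and [beta j] turn left multiplication by l in L into left multiplication by the
   conjugate of l by t_j, again in L. *)
pose alpha (j : 'I_n.+1) y := (t j * y)%g.
pose cf := config (1%g :: E') t.
pose beta (j : 'I_n.+1) th y := (conjugate (t j) (r y) * cf th)%g.
pose J : mean R 'I_n.+1 := mean_avg (fun j => mean_dirac R j).
pose b s := J (fun j => prism M1 (alpha j) (beta j) f s).
(* [F] no longer depends on s, so its mean can serve as the constant [b.2]. *)
pose F (ths : seq (seq (seq G))) := f (map cf ths).
exists (b, mpow M1 p F); split => /=.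
- move=> l s Ll; rewrite /b; congr (J _); apply/funext => j.
  rewrite (@prism_map _ _ _ _ M1 _ _ _ ( *%g (conjugate (t j) l))).
  + congr prism; apply/funext => u; apply: fL.
    by have [_ LM LV] := Lgroup; apply: (LM); [exact: LM | exact: LV].
  + by move=> y; rewrite /alpha /conjugate -!mulgA mulKg.
  + by move=> th y; rewrite /beta rM // conjugateM -[LHS]mulgA.
- by move=> s; apply: mean_norm_le => j; apply: prism_norm_le.
- by apply: (@mean_norm_le _ _ (mpow M1 p)) => ths; exact: fC.
move=> s sp sE.
have -> : sdiff b s + f s = J (fun j => prand M1 (beta j) f s).
  rewrite /b (sdiff_mean J (fun j => prism M1 (alpha j) (beta j) f)).
  rewrite -[f s](mean_cst J) -meanD; congr (J _); apply/funext => j.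
  have := prism_homotopy M1 (alpha j) (beta j) f s.
  rewrite (@eq_prism _ _ _ _ M1 _ _ _ (fun=> 0)) => [|u us]; last by rewrite fcocycle // us sp.
  have -> : prism M1 (alpha j) (beta j) (fun=> 0) s = 0.
    apply/eqP; rewrite -normr_le0 -[leRHS](mulr0 (size s)%:R).
    by apply: prism_norm_le => u; rewrite /= normr0.
  by rewrite addr0 => ->; rewrite fL // subrK.
have := nP (map r s) F; rewrite size_map => /(_ sp).
have -> : J (fun j => prand M1 (beta j) f s) = n.+1%:R^-1 *
   \sum_(j < n.+1) mpow M1 p (fun ths => F (act2 (insert_letter j) (map r s) ths)).
  rewrite /J /=; congr (_ * _); apply: eq_bigr => j _.
  rewrite prandE sp; congr (mpow_fun _ _ _); apply/funext => ths.
  rewrite /F /act2 -map_comp; congr f.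
  elim: s ths sE {sp} => [|y s IH] [|th ths] //= sE; congr (_ :: _).
    rewrite /cf config_insert // E'E inE sE ?mem_head ?orbT //.
  by apply: IH => z zs; apply: sE; rewrite inE zs orbT.
apply=> [_ /mapP[y ys ->]|u]; last exact: fC.
by rewrite E'E inE sE ?orbT.
Qed.

Let dir : set_system (seq G * nat) := fun A =>
  exists (E0 : seq G) (n0 : nat), forall (E : seq G) n, 
    {subset E0 <= E} -> (n0 <= n)%N -> A (E, n).

Let dir_filter : ProperFilter dir.
Proof.
split; first by move=> [E0 [n0 /(_ E0 n0)]]; apply.
split.
- by exists [::], 0%N.
- move=> A B [E [n EA]] [E' [n' EB]]; exists (E ++ E'), (maxn n n') => E1 n1 sub.
  rewrite geq_max => /andP[? ?]; split.
    by apply: EA => // e eE; apply: sub; rewrite mem_cat eE.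
  by apply: EB => // e eE; apply: sub; rewrite mem_cat eE orbT.
- move=> A B AB [E [n EA]]; exists E, n => *; apply: AB; exact: EA.
Qed.

Lemma bounded_cocycle_exact : (0 < p)%N -> exists b : seq G -> R,
  [/\ forall l s, L l -> b (map ( *%g l) s) = b s,
      forall s : seq G, exists D, forall s' : seq G, size s' = size s -> `|b s'| <= D &
      forall s, size s = p -> sdiff b s = f s].
Proof.
move=> p0.
have ap (i : seq G * nat) : exists b : (seq G -> R) * R,
  [/\ forall l s, L l -> b.1 (map ( *%g l) s) = b.1 s,
      forall s, `|b.1 s| <= (size s)%:R * C,
      `|b.2| <= C &
      forall s, size s = p -> (forall y, y \in s -> r y \in i.1) ->
        `|sdiff b.1 s + f s - b.2| <= i.2.+1%:R^-1].
  have [||b [b1 b2 b3 b4]] := @approximate_primitive [seq e <- i.1 | `[< L e >]] i.2.+1%:R^-1.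
  - by move=> e; rewrite mem_filter => /andP[/asboolP].
  - by rewrite invr_gt0.
  exists b; split => // s sp si; apply: b4 => // y ys.
  by rewrite mem_filter si // andbT; exact/asboolP.
have [B /all_and4[BL BC cC Bf]] := choice ap.
have [Lim LimP] := glim_exists R dir_filter.
pose b s := Lim (fun i => (B i).1 s); pose c := Lim (fun i => (B i).2).
have bb u : bounded_family (fun i => (B i).1 u) by exists ((size u)%:R * C).
have bc : bounded_family (fun i => (B i).2) by exists C.
have bf s : size s = p -> sdiff b s + f s - c = 0.
  move=> sp; have [e1 b1] := glim_sdiff LimP s bb.
  rewrite -/b in e1; rewrite e1.
  have -> : Lim (fun i => sdiff (B i).1 s) + f s - c =
      Lim (fun i => sdiff (B i).1 s - (- f s) - (B i).2).
    rewrite (glimB LimP) //; last first.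
      by apply: bounded_familyB => //; exact: bounded_family_cst.
    rewrite (glimB LimP) //; last exact: bounded_family_cst.
    by rewrite (glim_cst LimP) opprK.
  apply/eqP; rewrite -normr_le0; apply/ler_addgt0Pr => eps eps0; rewrite add0r.
  apply: (glim_norm_le LimP).
    by do 2!apply: bounded_familyB => //; exact: bounded_family_cst.
  exists (map r s), (Num.bound eps^-1) => E n sE ni /=; rewrite opprK.
  apply: (le_trans (Bf (E, n) s sp _)) => /=.
    by move=> y ys; apply: sE; exact: map_f.
  rewrite -[leRHS]invrK lef_pV2 ?posrE ?invr_gt0 //.
  have e0 : 0 <= eps^-1 by rewrite invr_ge0 ltW.
  apply: ltW; apply: (lt_le_trans (archi_boundP e0)); rewrite ler_nat.
  exact: (leq_trans ni).
have bL l s : L l -> b (map ( *%g l) s) = b s.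
  by move=> Ll; rewrite /b; congr Lim; apply/funext => i; exact: BL.
have bC s : `|b s| <= (size s)%:R * C.
  apply: (glim_norm_le LimP) => //; exists [::], 0%N => E n _ _ /=.
  exact: BC.
(* In the limit f = c - sdiff b. For odd p, c is the differential of the constant c; for even p, the
   cocycle condition on p + 1 entries forces c = 0. *)
exists (fun s => c - b s); split.
- by move=> l s Ll; rewrite bL.
- move=> s; exists (`|c| + (size s)%:R * C) => s' s's.
  by apply: (le_trans (ler_normB _ _)); rewrite lerD2l -s's.
move=> s sp; rewrite sdiffB sdiff_cst sp.
have fs : f s = c - sdiff b s.
  by have := bf s sp; move=> H; apply/eqP; rewrite -subr_eq0 -[eqbRHS]H; apply/eqP; ring.
rewrite fs; case: ifPn => // ep; suff -> : c = 0 by [].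
have e1 : (size (nseq p.+1 (1%g : G))) = p.+1 by rewrite size_nseq.
have := fcocycle e1.
rewrite (eq_sdiff_size (g := fun u => c - sdiff b u)).
  by rewrite sdiffB sdiff_cst e1 [odd _]/= ep (sdiff_sdiff b) subr0.
move=> u; rewrite size_nseq => -[up].
by have := bf u up; move=> H; apply/eqP; rewrite -subr_eq0 -[eqbRHS]H; apply/eqP; ring.
Qed.

End Acyclicity.

Lemma commuting_conjugates_exact (R : realType) (G : groupType) (L : G -> Prop)
    (f : seq G -> R) p : is_subgroup L -> commuting_conjugates L ->
  (exists C, forall s, size s = p.+1 -> `|f s| <= C) ->
  (forall l s, L l -> f (map ( *%g l) s) = f s) ->
  (forall s, size s = p.+2 -> sdiff f s = 0) ->
  exists b : seq G -> R,
  [/\ forall l s, L l -> b (map ( *%g l) s) = b s,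
      exists C, forall s, size s = p -> `|b s| <= C &
      forall s, size s = p.+1 -> sdiff b s = f s].
Proof.
move=> LG LC [C fC] fL fc; have [r rL rM] := coset_retraction LG.
(* Truncation to length p + 1 makes [f'] bounded everywhere; faces of sequences of length p + 2 are
   unaffected. *)
pose f' s := if size s == p.+1 then f s else 0.
have [||||b [bL bC bf]] := @bounded_cocycle_exact R G L LG LC f' p.+1 C _ _ _ r rL rM.
- move=> s; rewrite /f'; case: eqP => [/fC//|_]; rewrite normr0.
  by apply: le_trans (fC (nseq p.+1 1%g) _) => //; rewrite size_nseq.
- by move=> l s Ll; rewrite /f' size_map fL.
- move=> s sp; rewrite -[RHS](fc s sp); apply: eq_sdiff_size => u.
  by rewrite sp /f' => -[->]; rewrite eqxx.
- by [].
exists b; split=> //; last by move=> s sp; rewrite bf // /f' sp eqxx.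
by have [D bD] := bC (nseq p 1%g); exists D => s sp; apply: bD; rewrite size_nseq.
Qed.

(** * Actions that are highly transitive on generic tuples *)

Section GenericAction.
Variables (R : realType) (G : groupType) (X B : eqType).
Variables (act : G -> X -> X) (base : X -> B).
Hypothesis act1 : forall x, act 1%g x = x.
Hypothesis actM : forall g h x, act (g * h)%g x = act g (act h x).
Hypothesis base_act : forall g x y,
  (base (act g x) == base (act g y)) = (base x == base y).

Definition generic (xs : seq X) : bool := uniq (map base xs).

Hypothesis generic_transitive : forall xs ys, generic xs -> generic ys ->
  size xs = size ys -> exists g, map (act g) xs = ys.
Hypothesis base_infinite : forall bs : seq B, exists x, base x \notin bs.
Hypothesis stabilizer_commuting : forall xs, generic xs -> (0 < size xs)%N ->
  commuting_conjugates (fun g => map (act g) xs = xs).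

Implicit Types (w u v : seq G -> seq X -> R) (gs : seq G) (xs : seq X).

Lemma map_act1 xs : map (act 1%g) xs = xs.
Proof. by rewrite -[RHS]map_id; apply: eq_map => x; rewrite act1. Qed.

Lemma map_actM g h xs : map (act (g * h)%g) xs = map (act g) (map (act h) xs).
Proof. by rewrite -map_comp; apply: eq_map => x; rewrite actM. Qed.

Lemma map_actK g xs : map (act g^-1%g) (map (act g) xs) = xs.
Proof. by rewrite -map_actM mulVg map_act1. Qed.

Lemma map_mulA (g h : G) gs : map ( *%g g) (map ( *%g h) gs) = map ( *%g (g * h)%g) gs.
Proof. by rewrite -map_comp; apply: eq_map => k /=; rewrite mulgA. Qed.

Lemma generic_act g xs : generic (map (act g) xs) = generic xs.
Proof.
rewrite /generic; elim: xs => //= x xs ->; congr (~~ _ && _).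
by elim: xs => //= y xs IH; rewrite !inE IH base_act.
Qed.

Lemma generic_subseq xs ys : subseq xs ys -> generic ys -> generic xs.
Proof. by move=> s; apply: subseq_uniq; exact: map_subseq. Qed.

Lemma generic_exists n : exists2 xs, generic xs & size xs = n.
Proof.
elim: n => [|n [xs gx sx]]; first by exists [::].
have [x bx] := base_infinite (map base xs).
by exists (x :: xs); [rewrite /generic /= bx | rewrite /= sx].
Qed.

Lemma stabilizer_subgroup xs : is_subgroup (fun g => map (act g) xs = xs).
Proof.
split=> [|g h gx hx|g gx]; first exact: map_act1.
  by rewrite map_actM hx.
by rewrite -{1}gx map_actK.
Qed.

(** Cochains stay total functions on all tuples, generic or not; genericity enters only through
    [agree]. *)
Definition admissible (a c : nat) w : Prop :=
  (exists C, forall gs xs, size gs = a -> size xs = c -> `|w gs xs| <= C) /\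
  (forall h gs xs, w (map ( *%g h) gs) (map (act h) xs) = w gs xs).

Definition agree (a c : nat) w u : Prop :=
  forall gs xs, size gs = a -> size xs = c -> generic xs -> w gs xs = u gs xs.

Definition gdiff w : seq G -> seq X -> R := fun gs xs => sdiff (w^~ xs) gs.
Definition xdiff w : seq G -> seq X -> R := fun gs xs => sdiff (w gs) xs.
Definition cochain0 : seq G -> seq X -> R := fun _ _ => 0.

Lemma admissibleB a c w u : admissible a c w -> admissible a c u ->
  admissible a c (fun gs xs => w gs xs - u gs xs).
Proof.
move=> [[C wC] wI] [[D uD] uI]; split; last by move=> h gs xs; rewrite wI uI.
exists (C + D) => gs xs ga xc; apply: (le_trans (ler_normB _ _)).
by apply: lerD; [exact: wC | exact: uD].
Qed.

Lemma admissible_gdiff a c w : admissible a c w -> admissible a.+1 c (gdiff w).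
Proof.
move=> [[C wC] wI]; split.
  exists (a.+1%:R * C) => gs xs ga xc; rewrite -ga.
  apply: sdiff_bound => us; rewrite ga => -[ua]; exact: wC.
move=> h gs xs; rewrite /gdiff -sdiff_map; congr sdiff.
by apply/funext => us; rewrite wI.
Qed.

Lemma admissible_xdiff a c w : admissible a c w -> admissible a c.+1 (xdiff w).
Proof.
move=> [[C wC] wI]; split.
  exists (c.+1%:R * C) => gs xs ga xc; rewrite -xc.
  apply: sdiff_bound => us; rewrite xc => -[uc]; exact: wC.
move=> h gs xs; rewrite /xdiff -sdiff_map; congr sdiff.
by apply/funext => us; rewrite wI.
Qed.

Lemma gdiff_xdiff w : gdiff (xdiff w) = xdiff (gdiff w).
Proof. by apply/funext => gs; apply/funext => xs; exact: sdiff_swap. Qed.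

Lemma agree_gdiff a c w u : agree a c w u -> agree a.+1 c (gdiff w) (gdiff u).
Proof.
move=> wu gs xs ga xc gx; apply: eq_sdiff_size => vs.
by rewrite ga => -[va]; exact: wu.
Qed.

Lemma agree_xdiff a c w u : agree a c w u -> agree a c.+1 (xdiff w) (xdiff u).
Proof.
move=> wu gs xs ga xc gx; apply: eq_sdiff_subseq => vs vx.
rewrite xc => -[vc]; apply: wu => //; exact: generic_subseq gx.
Qed.

(** Fix one generic tuple s: [w] at s is a bounded cocycle invariant under the stabilizer of s, so
    it has a primitive, which transitivity transports to all generic tuples. *)
Lemma column_exact a c w : admissible a.+1 c.+1 w ->
  agree a.+2 c.+1 (gdiff w) cochain0 ->
  exists2 u, admissible a c.+1 u & agree a.+1 c.+1 (gdiff u) w.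
Proof.
move=> [[C wC] wI] dw; have [s gs ss] := generic_exists c.+1.
have sc : commuting_conjugates (fun g => map (act g) s = s).
  by apply: stabilizer_commuting => //; rewrite ss.
have [|||b [bL [D bD] bw]] :=
  @commuting_conjugates_exact R G _ (w^~ s) a (stabilizer_subgroup s) sc.
- by exists C => gs' ga; exact: wC.
- by move=> l gs' ls /=; rewrite -{1}ls wI.
- by move=> gs' ga; exact: dw.
pose tau xs := xget 1%g [set g | map (act g) s = xs]%classic.
have tauP xs : generic xs -> size xs = c.+1 -> map (act (tau xs)) s = xs.
  move=> gx xc; apply: (@xgetPex _ 1%g [set g | map (act g) s = xs]%classic).
  by have [|g gsx] := generic_transitive gs gx; [rewrite ss xc | exists g].
exists (fun gs xs => if generic xs && (size xs == c.+1) then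
    b (map ( *%g (tau xs)^-1%g) gs) else 0).
  split.
    exists D => gs' xs ga xc; case: ifP => _; first by apply: bD; rewrite size_map.
    rewrite normr0; apply: le_trans (bD (nseq a 1%g) _) => //.
    exact: size_nseq.
  move=> h gs' xs; rewrite generic_act size_map; case: ifP => // /andP[gx /eqP xc].
  (* [l] stabilizes s: the choice [tau] is equivariant up to the stabilizer, under which [b] is
     invariant. *)
  rewrite map_mulA; set l := ((tau (map (act h) xs))^-1 * h * tau xs)%g.
  have -> : ((tau (map (act h) xs))^-1 * h = l * (tau xs)^-1)%g by rewrite /l mulgK.
  rewrite -map_mulA bL // /l !map_actM tauP //.
  have e : map (act (tau (map (act h) xs))) s = map (act h) xs.
    by rewrite tauP ?generic_act ?size_map.
  by rewrite -[X in map _ X]e map_actK.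
move=> gs' xs ga xc gx; rewrite /gdiff gx xc eqxx /= sdiff_map bw ?size_map //.
rewrite -(wI (tau xs)) map_mulA mulgV tauP //; congr w.
by rewrite -[RHS]map_id; apply: eq_map => k; rewrite mul1g.
Qed.

Let cofinite : set_system X := fun A =>
  exists bs : seq B, forall x, base x \notin bs -> A x.

Let cofinite_filter : ProperFilter cofinite.
Proof.
split; first by move=> [bs bsP]; have [x /bsP] := base_infinite bs.
split; first by exists [::].
- move=> P Q [bs Pbs] [cs Qcs]; exists (bs ++ cs) => x.
  by rewrite mem_cat negb_or => /andP[/Pbs Px /Qcs Qx].
- by move=> P Q PQ [bs Pbs]; exists bs => x /Pbs; exact: PQ.
Qed.

(** Without group entries, invariance and transitivity make [w] constant on generic tuples. If c + 1
    is odd, the constant is a coboundary; if c + 1 is even, closedness forces it to vanish. *)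
Lemma row_exact0 c w : admissible 0 c.+1 w -> agree 0 c.+2 (xdiff w) cochain0 ->
  exists2 v, admissible 0 c v & agree 0 c.+1 (xdiff v) w.
Proof.
move=> [_ wI] dw; have [s gs ss] := generic_exists c.+1.
have wk xs : generic xs -> size xs = c.+1 -> w [::] xs = w [::] s.
  move=> gx xc; have [|g <-] := generic_transitive gs gx; first by rewrite xc.
  exact: (wI g [::]).
pose k := if odd c.+1 then w [::] s else 0.
exists (fun _ _ => k); first by split => //; exists `|k|.
move=> gs' xs /size0nil -> xc gx; rewrite /xdiff sdiff_cst xc wk // /k.
have [//|oc] := boolP (odd c.+1); have [t gt tc] := generic_exists c.+2.
have := dw [::] t erefl tc gt.
rewrite /xdiff (@eq_sdiff_subseq _ _ _ (fun=> w [::] s)).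
  by rewrite sdiff_cst tc [odd _]/= oc.
move=> us ut; rewrite tc => -[uc]; apply: wk => //; exact: generic_subseq gt.
Qed.

Lemma row_exactS a c w : admissible a.+1 c.+1 w ->
  agree a.+1 c.+2 (xdiff w) cochain0 ->
  exists2 v, admissible a.+1 c v & agree a.+1 c.+1 (xdiff v) w.
Proof.
move=> [[C wC] wI] dw; have [Lim LimP] := glim_exists R cofinite_filter.
(* Translating the apex y by the first group element makes the cone equivariant. *)
pose h gs y xs := if (size gs == a.+1) && (size xs == c) then
  w gs (act (head 1%g gs) y :: xs) else 0.
have C0 : 0 <= C.
  have [s _ ss] := generic_exists c.+1; apply: le_trans (wC (nseq a.+1 1%g) s _ ss) => //.
  by rewrite size_nseq.
have hC gs y xs : `|h gs y xs| <= C.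
  rewrite /h; case: ifP => [/andP[/eqP ga /eqP xc]|_]; last by rewrite normr0.
  by apply: wC => //=; rewrite xc.
have hb gs xs : bounded_family (fun y => h gs y xs) by exists C.
exists (fun gs xs => if size gs == a.+1 then Lim (fun y => h gs y xs) else 0).
  split.
    exists C => gs xs ga xc; rewrite ga eqxx; apply: (glim_norm_le LimP) => //.
    by exists [::] => y _; exact: hC.
  move=> l gs xs; rewrite size_map; case: eqP => // ga; congr Lim.
  apply/funext => y; rewrite /h !size_map; case: ifP => // _.
  by case: gs ga => // g gs _ /=; rewrite actM; exact: (wI l (g :: gs) (act g y :: xs)).
move=> gs xs ga xc gx; rewrite /xdiff ga eqxx.
have [-> bh] := @glim_sdiff _ _ _ _ LimP _ (h gs) xs
  (fun us => ex_intro _ C (fun y => hC gs y us)).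
apply: (glim_eq_cst cofinite_filter LimP) => //; set g := head 1%g gs.
(* For these y the cone [act g y :: xs] is generic, and closedness of [w] on it is the required
   identity. *)
exists (map (base \o act g^-1%g) xs) => y ynot /=.
have gy : generic (act g y :: xs).
  rewrite /generic /= -/(generic xs) gx andbT; apply: contra ynot => /mapP[x xxs e].
  apply/mapP; exists x => //=; apply/eqP; rewrite -(base_act g) -actM mulgV act1.
  by rewrite e.
have := dw gs (act g y :: xs) ga _ gy; rewrite /xdiff /= xc => /(_ erefl)/eqP.
rewrite subr_eq0 => /eqP ->; apply: eq_sdiff_size => us.
by rewrite xc => -[uc]; rewrite /h ga uc !eqxx.
Qed.

Lemma row_exact a c w : admissible a c.+1 w ->
  agree a c.+2 (xdiff w) cochain0 ->
  exists2 v, admissible a c v & agree a c.+1 (xdiff v) w.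
Proof. by case: a => [|a]; [exact: row_exact0 | exact: row_exactS]. Qed.

(* Diagram chase: a cochain closed in both directions is primitived along its column,
   the defect is corrected by induction and along a row, until a = 0 where it vanishes. *)
Lemma double_cocycle a c w : admissible a c.+1 w ->
  agree a.+1 c.+1 (gdiff w) cochain0 -> agree a c.+2 (xdiff w) cochain0 ->
  if a is a'.+1 then
    exists2 v, admissible a' c v & agree a c.+1 w (gdiff (xdiff v))
  else agree 0 c.+1 w cochain0.
Proof.
elim: a c w => [|a IH] c w wA gw xw.
  move=> gs xs /size0nil -> xc gx; rewrite -[RHS](gw [:: 1%g] xs) //.
  by rewrite /gdiff /= subr0.
have [u uA uw] := column_exact wA gw.
have xu0 : agree a.+1 c.+2 (gdiff (xdiff u)) cochain0.
  move=> gs xs ga xc gx; rewrite gdiff_xdiff (agree_xdiff uw) //; exact: xw.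
(* By induction [xdiff u] agrees with [gdiff (xdiff v)]; subtracting [gdiff v] from u removes this
   defect without changing [gdiff u]. If a = 0, the defect already vanishes. *)
have [u1 u1A [u1w xu1]] : exists2 u1, admissible a c.+1 u1 &
    agree a.+1 c.+1 w (gdiff u1) /\ agree a c.+2 (xdiff u1) cochain0.
  have := IH c.+1 (xdiff u) (admissible_xdiff uA) xu0.
  have -> : xdiff (xdiff u) = cochain0.
    by apply/funext => gs; apply/funext => xs; exact: sdiff_sdiff.
  move=> /(_ (fun _ _ _ _ _ => erefl)).
  case: a uA uw {IH xu0} wA gw xw => [|a] uA uw wA gw xw.
    by move=> xu; exists u => //; split=> // gs xs ga xc gx; rewrite uw.
  move=> [v vA xu]; exists (fun gs xs => u gs xs - gdiff v gs xs).
    by apply: admissibleB => //; exact: admissible_gdiff.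
  split=> gs xs ga xc gx.
    rewrite /gdiff sdiffB [X in _ = _ - X](_ : _ = 0) ?subr0; last exact: sdiff_sdiff.
    by rewrite -(uw gs xs).
  rewrite /xdiff sdiffB; apply/eqP; rewrite subr_eq0; apply/eqP.
  by rewrite -[LHS]/(xdiff u gs xs) xu // gdiff_xdiff.
have [v vA vu] := row_exact u1A xu1; exists v => // gs xs ga xc gx.
by rewrite u1w // (agree_gdiff vu).
Qed.

Theorem generic_action_exact a (f : seq G -> R) :
  (exists C, forall gs, size gs = a.+1 -> `|f gs| <= C) ->
  (forall h gs, f (map ( *%g h) gs) = f gs) ->
  (forall gs, size gs = a.+2 -> sdiff f gs = 0) ->
  exists b : seq G -> R,
  [/\ exists C, forall gs, size gs = a -> `|b gs| <= C,
      forall h gs, b (map ( *%g h) gs) = b gs &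
      forall gs, size gs = a.+1 -> f gs = sdiff b gs].
Proof.
move=> [C fC] fI df.
(* Viewed as independent of the points of X, f is closed in their direction: over two entries a
   constant cancels. *)
have [|||v [[D vD] vI] fv] := @double_cocycle a.+1 0 (fun gs _ => f gs).
- by split=> //; exists C => gs xs ga _; exact: fC.
- by move=> gs xs ga _ _; exact: df.
- by move=> gs xs _ xc _; rewrite /xdiff sdiff_cst xc.
have [x _] := base_infinite [::].
(* At the one-entry tuple [[:: x]] the augmented differential evaluates v at the empty tuple. *)
exists (v^~ [::]); split.
- by exists D => gs ga; exact: vD.
- by move=> h gs; exact: (vI h gs [::]).
move=> gs ga; rewrite (fv gs [:: x]) // /gdiff; congr sdiff.
by apply/funext => us; rewrite /xdiff /= subr0.
Qed.

End GenericAction.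

(** * Extremely proximal topological full groups *)

Section CantorLike.
Local Open Scope quotient_scope.
Local Open Scope classical_set_scope.
Variable T : topologicalType.
Hypothesis hT : cantor_like T.

(** * Clopen subsets of a Cantor-like space *)

Lemma clopen_basis (x : T) (A : set T) : nbhs x A ->
  exists V : set T, [/\ clopen V, V x & V `<=` A].
Proof.
case: hT => _ cT sT zT Ax.
by have [V [Vx cV] VA] := zero_dimensional_cvg (x := x) sT zT cT Ax; exists V.
Qed.

Lemma clopen_nbhs (x : T) (V : set T) : clopen V -> V x -> nbhs x V.
Proof. by move=> [oV _] Vx; apply: open_nbhs_nbhs. Qed.

Lemma nbhs_notin (x : T) (F : seq T) : x \notin F -> nbhs x [set z | z \notin F].
Proof.
case: hT => _ _ _ zT; elim: F => [|a F IH]; first by move=> _; exact: filterE.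
rewrite inE negb_or => /andP[/zT[U [cU Ux Ua]] xF].
apply: filterS (filterI (clopen_nbhs cU Ux) (IH xF)) => z /= [Uz zF].
by rewrite inE negb_or zF andbT; apply/eqP => za; rewrite za in Uz.
Qed.

Lemma nbhs_all (I : eqType) (x : T) (E : seq I) (A : I -> set T) :
  (forall e, e \in E -> nbhs x (A e)) ->
  nbhs x [set z | forall e, e \in E -> A e z].
Proof.
elim: E => [|a E IH] EA; first exact: filterE.
have nE : nbhs x [set z | forall e, e \in E -> A e z].
  by apply: IH => e eE; apply: EA; rewrite inE eE orbT.
apply: filterS (filterI (EA a (mem_head _ _)) nE) => z /= [az Ez] e.
by rewrite inE => /predU1P[->|/Ez].
Qed.

Lemma clopen_cover (F : seq T) (A : set T) : (forall y, y \in F -> nbhs y A) ->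
  exists V, [/\ clopen V, forall y, y \in F -> V y & V `<=` A].
Proof.
elim: F => [|a F IH] FA; first by exists set0; split=> //; exact: clopen0.
have [V [cV FV VA]] : exists V, [/\ clopen V, forall y, y \in F -> V y & V `<=` A].
  by apply: IH => y yF; apply: FA; rewrite inE yF orbT.
have [U [cU Ua UA]] := clopen_basis (FA a (mem_head _ _)).
exists (U `|` V); split; first exact: clopenU.
  by move=> y; rewrite inE => /predU1P[->|/FV]; [left | right].
by move=> z [/UA|/VA].
Qed.

Lemma open_avoid (O : set T) (F : seq T) : open O -> O !=set0 ->
  exists2 x, O x & x \notin F.
Proof.
case: hT => /perfectTP pT _ _ zT.
suff : open O -> O !=set0 -> (O `&` [set z | z \notin F]) !=set0.
  by move=> + oO O0 => /(_ oO O0)[x [Ox xF]]; exists x.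
move=> oO [x Ox]; elim: F => [|a F [y [Oy yF]]]; first by exists x.
have [ya|ya] := eqVneq y a; last first.
  by exists y; split => //=; rewrite inE negb_or ya.
have : nbhs y (O `&` [set z | z \notin F]).
  by apply: filterI; [exact: open_nbhs_nbhs | exact: nbhs_notin].
rewrite nbhsE => -[W [oW Wy] WO]; apply: contrapT => none; apply: (pT y).
suff <- : W = [set y] by [].
apply/seteqP; split=> [z Wz|z ->] //=; apply: contrapT => zy; apply: none.
have [Oz zF] := WO _ Wz; exists z; split => //=.
by rewrite inE negb_or zF andbT -ya; exact/eqP.
Qed.

Lemma clopen_avoid (O : set T) (F : seq T) : open O -> O !=set0 ->
  exists V, [/\ clopen V, V !=set0, V `<=` O & forall y, y \in F -> ~ V y].
Proof.
move=> oO O0; have [x Ox xF] := open_avoid F oO O0.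
have [|V [cV Vx VO]] := @clopen_basis x (O `&` [set z | z \notin F]).
  by apply: filterI; [exact: open_nbhs_nbhs | exact: nbhs_notin].
exists V; split => //; first by exists x.
  by move=> z /VO[].
by move=> y yF /VO[_ /=]; rewrite yF.
Qed.

(** Cut O into two nonempty clopen pieces, keep one as a term of the sequence and go on cutting the
    other. *)
Lemma clopen_sequence (O : set T) : clopen O -> O !=set0 ->
  exists W : nat -> set T, [/\ forall j, clopen (W j), forall j, W j !=set0,
    forall j, W j `<=` O & forall j k z, j != k -> W j z -> ~ W k z].
Proof.
move=> cO O0.
have split1 (V : set T) : exists U : set T, clopen V -> V !=set0 ->
    [/\ clopen U, (V `&` U) !=set0 & (V `\` U) !=set0].
  have [[cV [x Vx]]|] := pselect (clopen V /\ V !=set0); last first.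
    by move=> nV; exists set0 => cV V0; case: nV.
  have [y Vy] := open_avoid [:: x] cV.1 (ex_intro _ x Vx).
  rewrite inE => yx; case: hT => _ _ _ /(_ _ _ yx)[U [cU Uy Ux]].
  by exists U => _ _; split=> //; [exists y | exists x].
have [U UP] := choice split1.
pose V j := iter j (fun V => V `\` U V) O.
have VP j : clopen (V j) /\ V j !=set0.
  elim: j => [|j [cV V0]]; first by [].
  have [cU _ D0] := UP _ cV V0; split => //.
  by rewrite [V _]/= setDE; apply: clopenI => //; exact: clopenC.
have Vdecr j k z : (j <= k)%N -> V k z -> V j z.
  move=> /subnK <-; elim: (k - j)%N => // n IH.
  by rewrite addSn => -[/IH].
have lt_disj j k z : (j < k)%N -> (V j `&` U (V j)) z -> ~ (V k `&` U (V k)) z.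
  by move=> jk [Vz Uz] [/(Vdecr _ _ _ jk) [_ nUz] _].
exists (fun j => V j `&` U (V j)); split.
- by move=> j; have [cV V0] := VP j; have [cU _ _] := UP _ cV V0; exact: clopenI.
- by move=> j; have [cV V0] := VP j; have [_ D0 _] := UP _ cV V0.
- by move=> j z [/(Vdecr 0 _ _ (leq0n j))].
- move=> j k z; rewrite neq_ltn => /orP[jk|kj] zj; first exact: lt_disj zj.
  by move=> zk; exact: (lt_disj _ _ _ kj zk).
Qed.

(** * Building elements of a full group *)

Variables (Gamma : groupClosed (homeo T)).
Hypothesis Gamma_full : is_topological_full_group Gamma.
Hypothesis Gamma_ep : extremely_proximal Gamma.

Let G : groupType := subgroup_type Gamma.

Definition ev (g : G) : T -> T := homeo_fun (val g : homeo T).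

Lemma evM g h x : ev (g * h)%g x = ev g (ev h x).
Proof. by []. Qed.

Lemma evK g x : ev g^-1%g (ev g x) = x.
Proof. by rewrite -evM mulVg. Qed.

Lemma evVK g x : ev g (ev g^-1%g x) = x.
Proof. by rewrite -evM mulgV. Qed.

Lemma ev_inj g : injective (ev g).
Proof. exact: can_inj (evK g). Qed.

Lemma ev_continuous g : continuous (ev g).
Proof. exact: homeo_continuous. Qed.

Lemma ev_ext g h : (forall x, ev g x = ev h x) -> g = h.
Proof. by move=> gh; apply/val_inj/homeo_ext. Qed.

Lemma ev_nbhs g x (A : set T) : nbhs (ev g x) A -> nbhs x (ev g @^-1` A).
Proof. exact: ev_continuous. Qed.

(** An involution is its own inverse, so local agreement with Gamma makes it a homeomorphism, and
    fullness puts it in Gamma. *)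
Lemma local_element (tau : T -> T) : involutive tau ->
  (forall x : T, exists g : G, \forall y \near x, tau y = ev g y) ->
  exists g : G, forall x, ev g x = tau x.
Proof.
move=> tauK tauG.
have ctau : continuous tau.
  move=> x A; have [g gx] := tauG x; rewrite (nbhs_singleton gx) => /ev_nbhs gA.
  by apply: filterS (filterI gx gA) => y /= [->].
pose f := Homeo tauK tauK ctau ctau.
have fG : f \in Gamma.
  suff : topological_full_group Gamma f by rewrite Gamma_full.
  move=> x; have [g gx] := tauG x; exists [set y | tau y = ev g y] => //.
  by exists (val g) => //; exact: (valP g).
by exists (exist _ f fG).
Qed.

(** Glue k on V, its inverse on the image of V, and the identity elsewhere. V and its image are
    disjoint, and all three pieces are clopen. *)
Lemma clopen_involution (V : set T) (k : G) : clopen V ->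
  (forall x, V x -> ~ V (ev k x)) ->
  exists tau : G, [/\ forall x, V x -> ev tau x = ev k x,
    forall x, V x -> ev tau (ev k x) = x &
    forall x, ~ V x -> ~ V (ev k^-1%g x) -> ev tau x = x].
Proof.
move=> cV Vk; have cV' : clopen (ev k^-1%g @^-1` V).
  by apply: preimage_clopen => //; exact: ev_continuous.
pose tau x := if `[< V x >] then ev k x else
  if `[< V (ev k^-1%g x) >] then ev k^-1%g x else x.
have tau1 x : V x -> tau x = ev k x by move=> Vx; rewrite /tau asboolT.
have tau2 x : V (ev k^-1%g x) -> tau x = ev k^-1%g x.
  move=> Vx; rewrite /tau asboolF ?asboolT // => Vx'.
  by apply: (Vk _ Vx); rewrite evVK.
have tau3 x : ~ V x -> ~ V (ev k^-1%g x) -> tau x = x.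
  by move=> Vx Vx'; rewrite /tau !asboolF.
have [] := @local_element tau.
- move=> x; have [Vx|Vx] := pselect (V x).
    by rewrite (tau1 x) // tau2 evK.
  have [Vx'|Vx'] := pselect (V (ev k^-1%g x)); first by rewrite (tau2 x) // tau1 // evVK.
  by rewrite !(tau3 x).
- move=> x; have [Vx|Vx] := pselect (V x).
    by exists k; apply: filterS (clopen_nbhs cV Vx) => y /tau1.
  have [Vx'|Vx'] := pselect (V (ev k^-1%g x)).
    by exists k^-1%g; apply: filterS (clopen_nbhs cV' Vx') => y /tau2.
  exists 1%g; apply: filterS (filterI (clopen_nbhs (clopenC set0 cV) Vx)
    (clopen_nbhs (clopenC set0 cV') Vx')) => y [] /tau3 + /[dup] => H /H.
  by [].
move=> g gtau; exists g; split=> x.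
- by move=> /tau1 <-.
- by move=> Vx; rewrite gtau tau2 evK.
- by move=> Vx Vx'; rewrite gtau tau3.
Qed.

Lemma commute_supports (a b : G) (A B : set T) :
  (forall z, A z -> ~ B z) -> (forall z, ~ A z -> ev a z = z) ->
  (forall z, ~ B z -> ev b z = z) -> commute a b.
Proof.
move=> AB aA bB; apply: ev_ext => z; rewrite !evM.
have stable (c : G) (C : set T) : (forall z, ~ C z -> ev c z = z) -> C z -> C (ev c z).
  move=> cC Cz; apply: contrapT => nC; apply: (nC).
  by rewrite (ev_inj (cC _ nC)).
have [Az|Az] := pselect (A z).
  by rewrite (bB z) ?(bB (ev a z)) //; apply: AB => //; exact: stable.
rewrite (aA z) //; have [Bz|Bz] := pselect (B z); last by rewrite (bB z) // aA.
by apply: aA => Abz; apply: (AB _ Abz); exact: stable.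
Qed.

(** The elements of E are trivial on a clopen neighbourhood D of [ys]. Take disjoint clopen sets W_j
    inside D away from [ys] and involutions [tau j] carrying the complement of D into W_j: the
    conjugates by [tau j] are supported in W_j. *)
Lemma commuting_conjugates_fixing (ys : seq T) : (0 < size ys)%N ->
  commuting_conjugates
    (fun g : G => forall y, y \in ys -> \forall z \near y, ev g z = z).
Proof.
move=> ys0 E EL.
have [D [cD ysD DE]] : exists D, [/\ clopen D, forall y, y \in ys -> D y &
    D `<=` [set z | forall e, e \in E -> ev e z = z]].
  apply: clopen_cover => y yys; apply: (nbhs_all (A := fun e => [set z | ev e z = z])).
  by move=> e /EL; apply.
have D0 : D !=set0 by case: ys ys0 ysD {EL} => // y ys _ /(_ y (mem_head _ _)); exists y.
have [O [cO O0 OD Oys]] := clopen_avoid ys cD.1 D0.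
have [W [cW W0 WO Wdisj]] := clopen_sequence cO O0.
have WT j : W j `<` [set: T].
  split=> // sub; case: ys ys0 Oys {ysD EL} => // y ys _ /(_ y (mem_head _ _)).
  by apply; apply: (WO j); exact: sub.
have [U0|/set0P U0] := eqVneq (~` D) set0.
  (* Here E acts trivially, while extreme proximality needs a nonempty set to move. *)
  exists (fun=> 1%g); split; first by move=> j y _; exact: filterE.
  have DT z : D z by apply: contrapT => nDz; rewrite -[False]/(set0 z) -U0.
  move=> j k e e' _ eE e'E; rewrite /conjugate invg1 !mulg1 !mul1g.
  by apply: ev_ext => z; rewrite !evM !(DE _ (DT _)).
have UT : ~` D `<` [set: T] by split=> // sub; have [x Dx] := D0; exact: (sub x).
have tauP j : exists tau : G,
    (forall z, ~ W j z -> D z -> ev tau z = z) /\ (forall z, ~ D z -> W j (ev tau z)).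
  have [gamma gG [gU _]] := Gamma_ep (cW j) (W0 j) (WT j) (clopenC set0 cD) U0 UT.
  pose k : G := exist _ gamma gG.
  have kU x : ~ D x -> W j (ev k x) by move=> Dx; apply: gU; exists x.
  have [|tau [t1 t2 t3]] := @clopen_involution (~` D) k (clopenC set0 cD).
    by move=> x /kU /WO /OD Dk; apply.
  exists tau; split=> z; last by move=> Dz; rewrite t1 //; exact: kU.
  move=> Wz Dz; apply: t3; first by apply.
  by move=> /kU; rewrite evVK.
have [tau tP] := choice tauP; exists tau; split.
  move=> j y yys; have [t1 _] := tP j.
  have Wy : (~` W j) y by move=> /WO; exact: Oys.
  apply: filterS (filterI (clopen_nbhs (clopenC set0 (cW j)) Wy)
    (clopen_nbhs cD (ysD _ yys))) => z [Wz Dz].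
  exact: t1.
have supp j e z : e \in E -> ~ W j z -> ev (conjugate (tau j) e) z = z.
  move=> eE Wz; have [_ t2] := tP j.
  have [Dz|Dz] := pselect (D (ev (tau j)^-1%g z)).
    by rewrite /conjugate !evM (DE _ Dz _ eE) evVK.
  by case: Wz; rewrite -[z](evVK (tau j)); exact: t2.
move=> j k e e' jk eE e'E.
by apply: (@commute_supports _ _ (W j) (W k)) => z; [exact: Wdisj | exact: supp | exact: supp].
Qed.

Lemma orbit_avoid (x : T) (F : seq T) : exists g : G, ev g x \notin F.
Proof.
have T0 : [set: T] !=set0 by exists x.
(* Avoiding x as well makes V a proper subset. *)
have [V [cV V0 _ VF]] := clopen_avoid (x :: F) openT T0.
have [y _ xy] := open_avoid [:: x] openT T0.
rewrite inE eq_sym in xy; case: hT => _ _ _ /(_ _ _ xy)[U [cU Ux Uy]].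
have [||gamma gG [gU _]] := @Gamma_ep V U cV V0 _ cU (ex_intro _ x Ux).
- by split=> // /(_ x Logic.I); apply: VF; exact: mem_head.
- by split=> // /(_ y Logic.I).
exists (exist _ gamma gG); apply/negP => gF.
apply: (VF (ev (exist _ gamma gG : G) x)); first by rewrite inE gF orbT.
by apply: gU; exists x.
Qed.

(** Take a clopen neighbourhood of p so small that it is disjoint from its image under k and both
    miss Z, and use the involution exchanging them. *)
Lemma move_germ_distinct (k : G) (p : T) (Z : seq T) :
  p != ev k p -> p \notin Z -> ev k p \notin Z ->
  exists h : G, (\forall y \near p, ev h y = ev k y) /\
    forall z, z \in Z -> \forall y \near z, ev h y = y.
Proof.
move=> pk pZ kZ; case: (hT) => _ _ _ /(_ _ _ pk)[U [cU Up Uk]].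
have [D [cD pD DZ]] : exists D, [/\ clopen D,
    forall y, y \in [:: p; ev k p] -> D y & D `<=` [set z | z \notin Z]].
  by apply: clopen_cover => y; rewrite !inE => /orP[]/eqP->; exact: nbhs_notin.
have Dp : D p by apply: pD; rewrite mem_head.
have Dk : D (ev k p) by apply: pD; rewrite !inE eqxx orbT.
pose V := (U `&` D) `&` ev k @^-1` (~` U `&` D).
have cV : clopen V.
  apply: clopenI; first exact: clopenI.
  apply: preimage_clopen; last exact: ev_continuous.
  by apply: clopenI => //; exact: (clopenC set0).
have [|h [h1 h2 h3]] := clopen_involution (k := k) cV.
  by move=> x [_ [nU _]] [[Uk' _] _]; exact: nU.
exists h; split; first by apply: filterS (clopen_nbhs cV _) => [y /h1|].
move=> z zZ; have nD : (~` D) z by move=> /DZ /=; rewrite zZ.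
apply: filterS (clopen_nbhs (clopenC set0 cD) nD) => y Dy; apply: h3.
  by move=> [[_ Dy'] _]; exact: Dy.
by move=> [_ [_]]; rewrite /= evVK.
Qed.

(** If k fixes p, no neighbourhood of p is disjoint from its image; go to another point m p first
    and return by k m^-1. *)
Lemma move_germ (k : G) (p : T) (Z : seq T) :
  p \notin Z -> ev k p \notin Z ->
  exists h : G, (\forall y \near p, ev h y = ev k y) /\
    forall z, z \in Z -> \forall y \near z, ev h y = y.
Proof.
move=> pZ kZ; have [kp|] := eqVneq p (ev k p); last by move=> ?; exact: move_germ_distinct.
have [m] := orbit_avoid p (p :: Z); rewrite inE negb_or => /andP[mp mZ].
have [|h1 [h1p h1Z]] := @move_germ_distinct m p Z _ pZ mZ; first by rewrite eq_sym.
have km : ev (k * m^-1)%g (ev m p) = p by rewrite evM evK -kp.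
have [|||h2 [h2p h2Z]] := @move_germ_distinct (k * m^-1)%g (ev m p) Z; rewrite ?km //.
exists (h2 * h1)%g; split.
  apply: filterS (filterI h1p (ev_nbhs h2p)) => y /= [h1y h2y].
  by rewrite evM h1y h2y evM evK.
move=> z zZ; apply: filterS (filterI (h1Z _ zZ) (h2Z _ zZ)) => y /= [h1y h2y].
by rewrite evM h1y.
Qed.

(** * Germs at a base point *)

Variable x0 : T.

(* Germs rather than points: the stabilizer of a germ consists of elements trivial on a
   neighbourhood, so finitely many of them are supported in a common clopen set that can
   be moved off itself infinitely often. *)
Definition same_germ (g h : G) : bool := `[< \forall y \near x0, ev g y = ev h y >].

Fact same_germ_equiv : equiv_class_of same_germ.
Proof.
split=> [g|g h|h g k].
- by apply/asboolP; exact: filterE.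
- by apply/asboolP/asboolP => gh; apply: filterS gh => y /esym.
- move=> /asboolP gh /asboolP hk; apply/asboolP.
  by apply: filterS (filterI gh hk) => y /= [-> ->].
Qed.

Canonical same_germ_rel := EquivRelPack same_germ_equiv.

Definition germ : Type := {eq_quot same_germ}.
HB.instance Definition _ := Choice.on germ.
HB.instance Definition _ := EqQuotient.on germ.

Definition germ_act (g : G) (x : germ) : germ := \pi_germ (g * repr x)%g.
Definition germ_base (x : germ) : T := ev (repr x) x0.

Lemma eq_germ (g h : G) :
  (\pi_germ g = \pi_germ h) <-> (\forall y \near x0, ev g y = ev h y).
Proof. by split=> [/eqmodP/asboolP|gh]; last exact/eqmodP/asboolP. Qed.

Lemma repr_germ g : \forall y \near x0, ev (repr (\pi_germ g)) y = ev g y.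
Proof. by apply/eq_germ; rewrite reprK. Qed.

Lemma germ_act_pi g h : germ_act g (\pi_germ h) = \pi_germ (g * h)%g.
Proof.
apply/eq_germ; apply: filterS (repr_germ h) => y.
by rewrite !evM => ->.
Qed.

Lemma germ_base_pi g : germ_base (\pi_germ g) = ev g x0.
Proof. exact: nbhs_singleton (repr_germ g). Qed.

Lemma germ_baseE g x : germ_base (germ_act g x) = ev g (germ_base x).
Proof. by rewrite germ_base_pi. Qed.

Lemma germ_act_eq g h x : (germ_act g x = germ_act h x) <->
  (\forall y \near germ_base x, ev g y = ev h y).
Proof.
split=> [/eq_germ gh|gh]; last by apply/eq_germ; exact: (ev_nbhs gh).
have : \forall y \near x0, ev g (ev (repr x) y) = ev h (ev (repr x) y) := gh.
rewrite -{1}(evK (repr x) x0) => /ev_nbhs H; apply: filterS H => y /=.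
by rewrite evVK.
Qed.

Lemma germ_act1 x : germ_act 1%g x = x.
Proof. by rewrite /germ_act mul1g reprK. Qed.

Lemma germ_actM g h x : germ_act (g * h)%g x = germ_act g (germ_act h x).
Proof. by rewrite germ_act_pi mulgA. Qed.

Lemma germ_base_act g x y :
  (germ_base (germ_act g x) == germ_base (germ_act g y)) = (germ_base x == germ_base y).
Proof. by rewrite !germ_baseE (inj_eq (@ev_inj g)). Qed.

Lemma germ_act_fix g x : (germ_act g x = x) <->
  (\forall y \near germ_base x, ev g y = y).
Proof. by rewrite -{2}(germ_act1 x) germ_act_eq. Qed.

Lemma germ_base_infinite (bs : seq T) : exists x, germ_base x \notin bs.
Proof. by have [g gx] := orbit_avoid x0 bs; exists (\pi_germ g); rewrite germ_base_pi. Qed.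

Lemma map_germ_act_fix g xs : (map (germ_act g) xs = xs) <->
  (forall y, y \in map germ_base xs -> \forall z \near y, ev g z = z).
Proof.
split=> [gxs y /mapP[x xxs ->]|gxs].
  by apply/germ_act_fix; apply: (eq_in_map (germ_act g) id xs).2 xxs; rewrite map_id.
rewrite -[RHS]map_id; apply/eq_in_map => x xxs; apply/germ_act_fix/gxs.
exact: map_f.
Qed.

(** Move the tail first by induction, then correct the head by an element that is trivial near the
    base points of [ys]. *)
Lemma germ_transitive xs ys : generic germ_base xs -> generic germ_base ys ->
  size xs = size ys -> exists g, map (germ_act g) xs = ys.
Proof.
elim: xs ys => [|x xs IH] [|y ys] //; first by exists 1%g.
move=> gx /[dup] gy; rewrite /generic /= => /andP[yys gys] [sxy].
have [g gxs] : exists g, map (germ_act g) xs = ys.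
  by apply: IH => //; move: gx => /andP[].
have : generic germ_base (map (germ_act g) (x :: xs)).
  by rewrite (generic_act germ_base_act).
rewrite /generic /= gxs => /andP[xys _]; set x' := germ_act g x in xys.
pose k : G := (repr y * (repr x')^-1)%g.
have kx : germ_act k x' = y by rewrite /germ_act /k mulgVK reprK.
have [|h [hk hys]] := @move_germ k (germ_base x') (map germ_base ys) xys.
  by rewrite -germ_baseE kx.
exists (h * g)%g; rewrite /= germ_actM -/x' (germ_act_eq h k x').2 // kx.
congr (_ :: _); rewrite -[RHS]((map_germ_act_fix h ys).2 hys) -gxs -map_comp.
by apply: eq_map => z; rewrite /= germ_actM.
Qed.

Lemma full_group_exact (R : realType) a (f : seq G -> R) :
  (exists C, forall gs, size gs = a.+1 -> `|f gs| <= C) ->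
  (forall h gs, f (map ( *%g h) gs) = f gs) ->
  (forall gs, size gs = a.+2 -> sdiff f gs = 0) ->
  exists b : seq G -> R,
  [/\ exists C, forall gs, size gs = a -> `|b gs| <= C,
      forall h gs, b (map ( *%g h) gs) = b gs &
      forall gs, size gs = a.+1 -> f gs = sdiff b gs].
Proof.
apply: (generic_action_exact germ_act1 germ_actM germ_base_act germ_transitive
  germ_base_infinite) => xs _ xs0.
have -> : (fun g => map (germ_act g) xs = xs) = (fun g =>
    forall y, y \in map germ_base xs -> \forall z \near y, ev g z = z).
  by apply/funext => g; apply/propext; exact: map_germ_act_fix.
by apply: commuting_conjugates_fixing; rewrite size_map.
Qed.

End CantorLike.

(** * From sequences to homogeneous cochains *)

Lemma quot_eq0 (V : zmodType) (I : zmodClosed V) (c : Quotient.quot I) :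
  repr c \in I -> c = 0.
Proof.
move=> cI; rewrite -[c]reprK; apply/eqP; rewrite -[eqbRHS](pi_zeror (s := Quotient.quot I)).
by rewrite -Quotient.idealrBE subr0.
Qed.

Section HomogeneousCochains.
Local Open Scope quotient_scope.
Variables (R : realType) (G : groupType).

Definition seq_of n (g : 'I_n -> G) : seq G := [seq g i | i <- enum 'I_n].

Lemma size_seq_of n (g : 'I_n -> G) : size (seq_of g) = n.
Proof. by rewrite size_map size_enum_ord. Qed.

Lemma nth_seq_of n (g : 'I_n -> G) (i : 'I_n) : nth 1%g (seq_of g) i = g i.
Proof. by rewrite (nth_map i) ?size_enum_ord // nth_ord_enum. Qed.

Lemma seq_of_nth n (s : seq G) : size s = n -> seq_of (fun i : 'I_n => nth 1%g s i) = s.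
Proof.
move=> sn; apply: (@eq_from_nth _ 1%g); rewrite size_seq_of // => i ilt.
exact: (nth_seq_of _ (Ordinal ilt)).
Qed.

Lemma seq_of_mul n (h : G) (g : 'I_n -> G) :
  seq_of (fun i => (h * g i)%g) = map ( *%g h) (seq_of g).
Proof. exact: (map_comp ( *%g h) g). Qed.

Lemma seq_of_lift n (g : 'I_n.+1 -> G) (i : 'I_n.+1) :
  take i (seq_of g) ++ drop i.+1 (seq_of g) = seq_of (g \o lift i).
Proof.
have st : size (take i (seq_of g)) = i by rewrite size_takel // size_seq_of ltnW.
apply: (@eq_from_nth _ 1%g).
  by rewrite size_cat st size_drop !size_seq_of; have := ltn_ord i; lia.
rewrite size_cat st size_drop size_seq_of subSS subnKC; last by rewrite -ltnS.
move=> j jn; rewrite (nth_seq_of (g \o lift i) (Ordinal jn)) /= -nth_seq_of.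
rewrite nth_cat st /= /bump; case: ltnP => ji; first by rewrite nth_take.
by rewrite nth_drop; congr nth; lia.
Qed.

Lemma sdiff_seq_of n (F : seq G -> R) (g : 'I_n.+2 -> G) :
  sdiff F (seq_of g) = differential (fun g' : 'I_n.+1 -> G => F (seq_of g')) g.
Proof.
rewrite sdiff_sum size_seq_of /differential; apply: eq_bigr => i _.
by rewrite seq_of_lift.
Qed.

Lemma bounded_funP (S : Type) (f : S -> R) :
  bounded_fun f <-> exists C, forall x, `|f x| <= C.
Proof.
split=> [[M [_ fM]]|[C fC]]; first by exists (M + 1) => x; apply: fM => //; rewrite ltrDl.
exists C; split; first exact: num_real.
by move=> M CM x _ /=; apply: le_trans (fC x) (ltW CM).
Qed.

Lemma boundedly_acyclic_seq :
  (forall a (f : seq G -> R),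
    (exists C, forall gs, size gs = a.+1 -> `|f gs| <= C) ->
    (forall h gs, f (map ( *%g h) gs) = f gs) ->
    (forall gs, size gs = a.+2 -> sdiff f gs = 0) ->
    exists b : seq G -> R,
    [/\ exists C, forall gs, size gs = a -> `|b gs| <= C,
        forall h gs, b (map ( *%g h) gs) = b gs &
        forall gs, size gs = a.+1 -> f gs = sdiff b gs]) ->
  boundedly_acyclic R G.
Proof.
move=> exact [//|m] _ c; apply: quot_eq0.
move: (repr c) => z; rewrite unfold_in /bcoboundary; apply/asboolP => /=.
have /asboolP[[zI /bounded_funP[C zC]] dz] := valP z.
pose f gs := if size gs == m.+2 then val z (fun i => nth 1%g gs i) else 0.
have fE (g : 'I_m.+2 -> G) : f (seq_of g) = val z g.
  by rewrite /f size_seq_of eqxx; congr (val z); apply/funext => i; rewrite nth_seq_of.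
(* Degree m + 1 means m + 2 arguments, hence the shift in the index. *)
have [|||b [[D bD] bI fb]] := exact m.+1 f.
- by exists C => gs gm; rewrite -(seq_of_nth gm) fE.
- move=> h gs; rewrite /f size_map; case: eqP => // gm; rewrite -[RHS](zI h).
  by congr (val z); apply/funext => i; rewrite (nth_map 1%g) // gm.
- move=> gs gm; rewrite -(seq_of_nth gm) sdiff_seq_of.
  transitivity (differential (val z) (fun i => nth 1%g gs i)); last by rewrite dz.
  by congr differential; apply/funext => g; rewrite fE.
exists (fun g : 'I_m.+1 -> G => b (seq_of g)).
  split; first by move=> h g; rewrite seq_of_mul bI.
  by apply/bounded_funP; exists D => g; apply: bD; rewrite size_seq_of.
by apply/funext => g; rewrite -fE fb ?size_seq_of // sdiff_seq_of.
Qed.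

End HomogeneousCochains.

Theorem theorem6p2 (R : realType) (Gamma : groupClosed (homeo cantor_space)) :
  is_topological_full_group Gamma ->
  extremely_proximal Gamma ->
  boundedly_acyclic R (subgroup_type Gamma).
Proof.
move=> full ep; apply: boundedly_acyclic_seq => a f fC fI df.
(* The germs are taken at [point], an arbitrary base point. *)
exact: (full_group_exact cantor_like_cantor_space full ep point fC fI df).
Qed.
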